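(* Let $X$ be a real random variable with finite variance and finite differential entropy, let $W\sim\mathcal N(0,\sigma_W^2)$ with $\sigma_W^2>0$ be independent of $X$, and let $Y=X+W$. Then $$h\big(\mathbb E[X\mid Y]\big)=h(Y)+\mathbb E\left[\log\left(\frac{1}{\sigma_W^2}\operatorname{Var}(X\mid Y)\right)\right],$$ and moreover $$h\big(\mathbb E[X\mid Y]\big)+h(Y)\ \ge\ 2h(X).$$
   Context: $h(\cdot)$ denotes differential entropy, $h(Z)=-\int p_Z(z)\log p_Z(z)\,dz$, with natural logarithm. $\operatorname{Var}(X\mid Y)=\mathbb E[(X-\mathbb E[X\mid Y])^2\mid Y]$ is the conditional variance (a function of $Y$). *)

(* Defs.v *)
From HB Require Import structures.
From mathcomp Require Import all_boot all_order all_algebra.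
From mathcomp Require Import all_classical all_reals all_analysis.
Set Implicit Arguments. Unset Strict Implicit. Unset Printing Implicit Defensive.
Import Order.TTheory GRing.Theory Num.Theory.
Local Open Scope classical_set_scope.
Local Open Scope ring_scope.
Local Open Scope ereal_scope.

Section defs.
Context {d : measure_display} {T : measurableType d} {R : realType}.
Variable P : probability T R.

Definition is_density (Z : T -> R) (p : R -> R) : Prop :=
  measurable_fun setT p /\ (forall x, (0 <= p x)%R) /\
  forall A : set R, measurable A ->
    P (Z @^-1` A) = \int[lebesgue_measure]_(x in A) (p x)%:E.

Definition indep2 (X W : T -> R) : Prop :=
  forall A B : set R, measurable A -> measurable B ->
    P (X @^-1` A `&` W @^-1` B) = P (X @^-1` A) * P (W @^-1` B).

Definition cond_exp_fun (Y Z : T -> R) (g : R -> R) : Prop :=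
  measurable_fun setT g /\
  P.-integrable setT (fun w => (g (Y w))%:E) /\
  forall B : set R, measurable B ->
    \int[P]_(w in Y @^-1` B) (Z w)%:E = \int[P]_(w in Y @^-1` B) (g (Y w))%:E.

(* v is a version of Var(X | Y) = E[(X - E[X|Y])^2 | Y], given a version g of E[X|Y] *)
Definition cond_var_fun (Y X : T -> R) (g v : R -> R) : Prop :=
  cond_exp_fun Y (fun w => (X w - g (Y w)) ^+ 2)%R v.
End defs.

Definition entropy {R : realType} (p : R -> R) : \bar R :=
  - \int[lebesgue_measure]_x (p x * ln (p x))%:E.

(* Main.v *)
Require Import Defs.
From HB Require Import structures.
From mathcomp Require Import all_boot all_order all_algebra.
From mathcomp Require Import all_classical all_reals all_analysis.
From mathcomp Require Import unstable measurable_realfun lebesgue_integral_under ring lra.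
Import Order.TTheory GRing.Theory Num.Theory.
Import numFieldNormedType.Exports.
Set Implicit Arguments.
Unset Strict Implicit.
Unset Printing Implicit Defensive.
Local Open Scope classical_set_scope.
Local Open Scope ring_scope.
Local Open Scope ereal_scope.

(** Write [phi] for the density of [W], [s = sigma^2], and [F k y = E[X^k phi (y - X)]].
    Then [f = F 0] is a density of [Y], the posterior mean is [m = F 1 / F 0], and
    differentiating under the expectation gives [m' = V / s], where [V = F 2 / F 0 - m^2] is
    the posterior variance. As [V > 0], the map [m] is increasing, so [m (Y)] has the density
    [q] with [q (m y) = f y / m' y], and the entropy identity is [ln (q (m Y)) = ln (f Y) - ln (V Y / s)].

    For the inequality, compare the joint density [p x * phi (y - x)] of [(X, Y)] with
    [f y * N (x; m y, V y)]: the exponential of the log-ratio [L] has expectation at most [1],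
    so [E L <= 0]. Since [E[(X - m Y)^2 / V Y] = 1 <= E[W^2 / s]], the quadratic terms of [L]
    contribute a nonnegative amount, and what remains is [2 h(Y) + E ln (V Y / s) >= 2 h(X)]. *)

(** In information-theoretic terms the inequality says that the posterior of [X] has at most the
    entropy of a Gaussian with the same variance: [h(X | Y) <= E ln(2 pi e V) / 2], where
    [h(X | Y) = h(X) + h(W) - h(Y)] and [h(W) = ln(2 pi e s) / 2]. The joint log-ratio [L] replaces
    conditional entropies by one expectation over [P]. The obstacle is finiteness: [V] may come
    close to 0, so [E ln V] could a priori be [-oo]. The pointwise bound [1 + L <= exp L] is
    therefore used twice, once as a lower bound on [ln V] that yields integrability, and only then
    inside an expectation. The same device, a ratio of densities with known mean, gives the
    integrability of [ln f (Y)] and both facts about the second moment of [W]. Conditional laws are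
    avoided as well: to find [E[u(X, Y) | Y]] it is enough to compute [E[u(X, y) phi (y - X)]] for
    each fixed [y] and divide by [f y]. *)

(** * Measures given by a density *)

Section density_measure.
Context d (T : measurableType d) (R : realType) (mu : {measure set T -> \bar R}).
Variables (f : T -> R) (mf : measurable_fun setT f) (f0 : forall x, (0 <= f x)%R).

(** Carrying the two proofs as arguments lets the measure instance below be inferred from the term
    itself. *)
Definition density_measure of measurable_fun setT f & (forall x, (0 <= f x)%R) :=
  fun A : set T => \int[mu]_(x in A) (f x)%:E.

Local Notation nu := (density_measure mf f0).

Let nu0 : nu set0 = 0.
Proof. by rewrite /density_measure integral_set0. Qed.

Let nu_ge0 A : 0 <= nu A.
Proof. by apply: integral_ge0 => x _; rewrite lee_fin. Qed.

Let nu_sigma_additive : semi_sigma_additive nu.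
Proof.
move=> F mF tF mUF; rewrite /density_measure ge0_integral_bigcup//; last 2 first.
- exact/measurable_EFinP/measurable_funTS.
- by move=> x _; rewrite lee_fin.
by apply: is_cvg_ereal_nneg_natsum_cond => n _ _; exact: nu_ge0.
Qed.

HB.instance Definition _ :=
  isMeasure.Build _ _ _ nu nu0 nu_ge0 nu_sigma_additive.

End density_measure.

Section integral_density.
Context d (T : measurableType d) (R : realType) (mu nu : {measure set T -> \bar R}).
Variables (f : T -> R) (mf : measurable_fun setT f) (f0 : forall x, (0 <= f x)%R).
Hypothesis nuE : forall A, measurable A -> nu A = \int[mu]_(x in A) (f x)%:E.

Import HBNNSimple.

(** [nuE] is the case of indicators; linearity gives simple functions and monotone convergence the
    rest. With [nu] arbitrary, the formula also serves for laws of random variables and for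
    [normal_prob]. *)
Lemma ge0_integral_density (h : T -> \bar R) : measurable_fun setT h ->
  (forall x, 0 <= h x) -> \int[nu]_x h x = \int[mu]_x (h x * (f x)%:E).
Proof.
move=> mh h0; pose h_ := nnsfun_approx measurableT mh.
transitivity (limn (fun n => \int[nu]_x (h_ n x)%:E)).
  rewrite -monotone_convergence//.
  - apply: eq_integral => y _; apply/esym/cvg_lim => //.
    exact: cvg_nnsfun_approx.
  - by move=> n; exact/measurable_EFinP/measurable_funP.
  - by move=> n y _; rewrite lee_fin.
  - by move=> y _ m n mn; rewrite lee_fin; exact/lefP/nd_nnsfun_approx.
rewrite [X in limn X](_ : _ = (fun n => \int[mu]_x ((h_ n x)%:E * (f x)%:E))).
  rewrite -monotone_convergence//; last 3 first.
  - move=> n; apply/emeasurable_funM; apply/measurable_EFinP => //.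
  - by move=> n x _; rewrite mule_ge0// lee_fin.
  - move=> x _ m n mn; rewrite lee_wpmul2r ?lee_fin//.
    exact/lefP/nd_nnsfun_approx.
  apply: eq_integral => x _; apply/cvg_lim => //.
  by apply: cvgeZr => //; exact: cvg_nnsfun_approx.
apply/funext => n.
transitivity (\sum_(k \in range (h_ n))
    \int[nu]_x (k * \1_(h_ n @^-1` [set k]) x)%:E).
  under eq_integral do rewrite fimfunE -fsumEFin//.
  rewrite ge0_integral_fsum//.
  - by move=> y; exact/measurable_EFinP/measurable_funM.
  - by move=> y x _; rewrite nnfun_muleindic_ge0.
transitivity (\sum_(k \in range (h_ n))
    \int[mu]_x ((k * \1_(h_ n @^-1` [set k]) x)%:E * (f x)%:E)).
  apply: eq_fsbigr => r; rewrite inE => -[t _ rt].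
  have r0 : (0 <= r)%R by rewrite -rt.
  under eq_integral do rewrite EFinM.
  under [RHS]eq_integral do rewrite EFinM -muleA.
  rewrite ge0_integralZl//; last first.
    exact/measurable_EFinP.
  rewrite ge0_integralZl//; last first.
  - by move=> x _; rewrite mule_ge0// lee_fin.
  - by apply/emeasurable_funM; apply/measurable_EFinP.
  rewrite integral_indic// setIT nuE//; congr (_ * _).
  rewrite integral_mkcond; apply: eq_integral => x _.
  rewrite patchE indicE; case: ifPn => _ ; first by rewrite mul1e.
  by rewrite mul0e.
rewrite -ge0_integral_fsum//.
- apply: eq_integral => x _; rewrite -ge0_mule_fsuml.
    by rewrite fsumEFin// -fimfunE.
  by move=> r; rewrite nnfun_muleindic_ge0.
- by move=> y; apply/emeasurable_funM; apply/measurable_EFinP => //;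
    exact: measurable_funM.
- by move=> y x _; rewrite mule_ge0 ?lee_fin// -lee_fin nnfun_muleindic_ge0.
Qed.

End integral_density.

(** * Measures on the line determined by half-open intervals; translation invariance *)

Section measures_on_the_line.
Context {R : realType}.
Local Notation mu := (@lebesgue_measure R).

Lemma measure_ocitv_unique (m1 m2 : {measure set (measurableTypeR R) -> \bar R}) :
  (forall a b : R, (a < b)%R -> m1 `]a, b]%classic = m2 `]a, b]%classic) ->
  (forall a b : R, m1 `]a, b]%classic < +oo) ->
  forall A, measurable A -> m1 A = m2 A.
Proof.
move=> m12 m1oo A mA.
apply: (@measure_unique _ R (measurableTypeR R) (@ocitv R) (fun k => [set` `](- k%:R)%R, k%:R%R]])) => //.
- exact: ocitvI.
- by move=> i; exact: is_ocitv.
- apply/seteqP; split => // x _; exists (Num.bound x) => //=.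
  by rewrite in_itv/= ltrNl ltrNbound ltW// ltr_bound.
- move=> X [[a b] _ <-] /=; have [ab|ba] := ltP a b; first exact: m12.
  by rewrite set_itv_ge ?bnd_simp -?leNgt// !measure0.
Qed.

Lemma ge0_integral_translation (x : R) (h : R -> \bar R) : measurable_fun setT h ->
  (forall y, 0 <= h y) -> \int[mu]_y h (x + y)%R = \int[mu]_y h y.
Proof.
move=> mh h0; have ms : measurable_fun setT (fun y : measurableTypeR R => (x + y)%R : measurableTypeR R).
  exact: measurable_funD.
have := @ge0_integral_pushforward _ _ _ _ R _ ms mu setT h measurableT mh (fun y _ => h0 y).
rewrite preimage_setT => <-; apply: eq_measure_integral => /= A mA _.
have E (a b : R) : pushforward mu (fun y : measurableTypeR R => (x + y)%R : measurableTypeR R)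
    [set` `]a, b]] = mu [set` `](a - x)%R, (b - x)%R]].
  congr (mu _); apply/seteqP; split => y /=; rewrite !in_itv/= => /andP[? ?];
    apply/andP; split; lra.
apply: (@measure_ocitv_unique (pushforward mu _) mu) => //.
- move=> a b ab; rewrite [LHS]E.
  rewrite lebesgue_measure_itv/= [RHS]lebesgue_measure_itv/= !lte_fin ltrD2r ab -!EFinD.
  by congr (_%:E); lra.
- move=> a b; rewrite [ltLHS]E.
  by rewrite lebesgue_measure_itv; case: ifP => _; rewrite -?EFinD ltry.
Qed.

End measures_on_the_line.

(** * Substitution along an increasing function that need not be onto *)

Section increasing_substitution.
Context {R : realType}.
Local Notation mu := (@lebesgue_measure R).
Variables F F' : R -> R.
Hypothesis dF : forall y : R, is_derive y 1%R F (F' y).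
Hypothesis F'_gt0 : forall y, (0 < F' y)%R.
Hypothesis cF' : continuous F'.

(** The range may be a proper interval: a bounded [X] has a bounded posterior mean. Outside the
    range the inverse takes the default value 0, so the formulas below restrict to [range F]. *)
Definition increasing_inverse (u : R) : R := xget 0%R [set y | F y = u].
Local Notation k := increasing_inverse.

Let cF : continuous F.
Proof.
by move=> y; apply/differentiable_continuous/derivable1_diffP; have [] := dF y.
Qed.

Let F_lt (x y : R) : (x < y)%R -> (F x < F y)%R.
Proof.
move=> xy; apply: (@gtr0_derive1_incr R F x y) => //.
- by move=> z _; rewrite derive1E; have [_ ->] := dF z.
- exact: continuous_subspaceT.
Qed.

Let F_le : {mono F : x y / (x <= y)%R}.
Proof. exact: le_mono F_lt. Qed.

Let F_ltm : {mono F : x y / (x < y)%R}.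
Proof. exact: leW_mono F_le. Qed.

Let kK y : k (F y) = y.
Proof.
rewrite /k; case: xgetP => [z _ /=|/(_ y) /=]; last by move=> /(_ erefl).
by move/(inc_inj F_le).
Qed.

Let Kk u : range F u -> F (k u) = u.
Proof. by move=> [y _ <-]; rewrite kK. Qed.

Let rangeE (a b u : R) : (a <= b)%R -> (F a <= u)%R -> (u <= F b)%R -> range F u.
Proof.
move=> ab au ub; have [c _ <-] : exists2 c, c \in `[a, b]%R & F c = u.
  apply: (@IVT R F a b u) => //; first exact: continuous_subspaceT.
  have Fab : (F a <= F b)%R by rewrite F_le.
  by rewrite (min_idPl Fab) (max_idPr Fab) au ub.
by exists c.
Qed.

Let rangeI (a b : R) : (a < b)%R ->
  range F `&` k @^-1` [set` `]a, b]] = [set` `]F a, F b]].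
Proof.
move=> ab; apply/seteqP; split => u /=; rewrite !in_itv/=.
  by move=> [[y _ <-]]; rewrite kK F_ltm F_le.
move=> /andP[au ub]; have ru := rangeE (ltW ab) (ltW au) ub; split => //.
by case: ru au ub => y _ <-; rewrite kK F_ltm F_le => -> ->.
Qed.

Let measurable_range : measurable (range F).
Proof.
have -> : range F = \bigcup_n [set` `]F (- n%:R)%R, F n%:R]%R].
  apply/seteqP; split => u /=.
    move=> [y _ <-]; exists (Num.bound y) => //=.
    by rewrite in_itv/= F_ltm F_le ltrNl ltrNbound ltW// ltr_bound.
  move=> [n _]/=; rewrite in_itv/= => /andP[nu un].
  by apply: rangeE (ltW nu) un; rewrite -subr_ge0 opprK addr_ge0.
by apply: bigcup_measurable.
Qed.

Let k0 u : ~ range F u -> k u = 0%R.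
Proof.
rewrite /k; case: xgetP => [z _ /= Fz|//] Fu.
by exfalso; apply: Fu; exists z.
Qed.

Lemma measurable_increasing_inverse : measurable_fun setT k.
Proof.
apply: (measurability (@ocitv R)) => // _ [_ [[a b] _ <-] <-] /=.
rewrite setTI; have [ab|ba] := ltP a b; last first.
  by rewrite set_itv_ge ?bnd_simp -?leNgt// preimage_set0.
rewrite -(setIT (k @^-1` _)) -(setUv (range F)) setIUr; apply: measurableU.
  by rewrite setIC rangeI.
(* Off the range the inverse is constantly 0, so this part of the preimage is the whole complement
   or empty, according to whether []a, b]] contains 0. *)
have [ab0|ab0] := pselect ([set` `]a, b]] (0%R : R)).
  rewrite (_ : _ `&` _ = ~` range F); first exact: measurableC.
  apply/seteqP; split => u /=; first by case.
  by move=> nu; split => //; rewrite k0.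
rewrite (_ : _ `&` _ = set0)//.
by apply/seteqP; split => u //= -[] + nu; rewrite k0.
Qed.

Let m01 : measurable_fun setT (\1_(range F) : R -> R).
Proof. exact: measurable_indic. Qed.

Let ge01 : forall u, (0 <= (\1_(range F) : R -> R) u)%R.
Proof. by move=> u; rewrite indicE. Qed.

Let mF' : measurable_fun setT F'.
Proof. exact: continuous_measurable_fun. Qed.

Let F'_ge0 y : (0 <= F' y)%R. Proof. exact: ltW. Qed.

Let densE (a b : R) : (a < b)%R -> density_measure mu mF' F'_ge0 [set` `]a, b]]
  = (F b - F a)%:E.
Proof.
move=> ab; rewrite /density_measure integral_itv_obnd_cbnd; last first.
  by apply/measurable_EFinP/measurable_funTS.
rewrite (@continuous_FTC2 _ F' F)//.
- exact: continuous_subspaceT.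
- split.
  + by move=> y _; have [] := dF y.
  + by apply: cvg_at_right_filter; exact: cF.
  + by apply: cvg_at_left_filter; exact: cF.
- by move=> y _; rewrite derive1E; have [_ ->] := dF y.
Qed.

Let mk : measurable_fun setT (k : measurableTypeR R -> measurableTypeR R).
Proof. exact: measurable_increasing_inverse. Qed.

Let nu := pushforward (density_measure mu m01 ge01)
    (k : measurableTypeR R -> measurableTypeR R).

Let nuE (A : set R) : measurable A -> nu A = mu (range F `&` k @^-1` A).
Proof.
move=> mA; rewrite /nu /pushforward /density_measure integral_indic//.
by rewrite -[X in measurable X]setTI; exact: measurable_increasing_inverse.
Qed.

(** Two measures coincide because both give []a, b]] the mass [F b - F a]: the one with density [F']
    by the fundamental theorem of calculus, and the image under [k] of Lebesgue measure on [range F]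
    because [k] pulls []a, b]] back to []F a, F b]]. *)
Lemma ge0_integral_increasing_inverse (h : R -> \bar R) : measurable_fun setT h ->
  (forall y, 0 <= h y) ->
  \int[mu]_y (h y * (F' y)%:E) = \int[mu]_(u in range F) h (k u).
Proof.
move=> mh h0.
rewrite -(@ge0_integral_density _ _ _ mu (density_measure mu mF' F'_ge0))//.
transitivity (\int[pushforward (density_measure mu m01 ge01)
    (k : measurableTypeR R -> measurableTypeR R)]_y h y).
  apply: eq_measure_integral => A mA _.
  apply: (@measure_ocitv_unique _ (density_measure mu mF' F'_ge0) (pushforward (density_measure mu m01 ge01)
    (k : measurableTypeR R -> measurableTypeR R))) => //.
  - move=> a b ab; rewrite [LHS]densE// [RHS]nuE// rangeI// lebesgue_measure_itv/=.
    by rewrite lte_fin F_ltm ab -EFinD.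
  - move=> a b; have [ab|ba] := ltP a b; first by rewrite [ltLHS]densE// ltry.
    rewrite set_itv_ge ?bnd_simp -?leNgt//.
    by rewrite [ltLHS](_ : _ = 0) ?ltry.
rewrite ge0_integral_pushforward//=.
rewrite preimage_setT (@ge0_integral_density _ _ _ mu _ _ m01 ge01)//; last first.
  exact: measurableT_comp measurable_increasing_inverse.
rewrite [RHS]integral_mkcond; apply: eq_integral => u _.
by rewrite patchE indicE /=; case: ifPn => _; rewrite ?mule1 ?mule0.
Qed.

Definition increasing_image_density (f : R -> R) (u : R) : R :=
  (\1_(range F) u * (f (k u) / F' (k u)))%R.

Let mV : measurable_fun setT (fun y => (F' y)^-1)%R.
Proof.
by apply: continuous_measurable_fun => y; apply: cvgV; [exact: lt0r_neq0|exact: cF'].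
Qed.

Lemma measurable_increasing_image_density (f : R -> R) :
  measurable_fun setT f -> measurable_fun setT (increasing_image_density f).
Proof.
move=> mf; apply: measurable_funM => //.
apply: (@measurableT_comp _ _ _ _ _ _ (fun y => f y / F' y)%R _ k).
  exact: measurable_funM.
exact: measurable_increasing_inverse.
Qed.

Lemma increasing_image_density_ge0 (f : R -> R) :
  (forall y, (0 <= f y)%R) -> forall u, (0 <= increasing_image_density f u)%R.
Proof. by move=> f0 u; rewrite mulr_ge0// divr_ge0. Qed.

Lemma increasing_image_densityE (f : R -> R) y :
  increasing_image_density f (F y) = (f y / F' y)%R.
Proof. by rewrite /increasing_image_density kK indicE mem_set ?mul1r//; exists y. Qed.

Lemma integral_increasing_image_density (f : R -> R) (A : set R) :
  measurable_fun setT f -> (forall y, (0 <= f y)%R) -> measurable A ->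
  \int[mu]_(y in F @^-1` A) (f y)%:E =
  \int[mu]_(u in A) (increasing_image_density f u)%:E.
Proof.
move=> mf f0 mA; have mFA : measurable (F @^-1` A).
  by rewrite -[X in measurable X]setTI; exact: continuous_measurable_fun.
(* Dividing by [F'] makes the substitution formula return [f] on one side and the image density on
   the other. *)
pose h y : \bar R := (\1_(F @^-1` A) y * (f y / F' y))%:E.
have h0 y : 0 <= h y by rewrite lee_fin mulr_ge0// divr_ge0.
have mh : measurable_fun setT h.
  apply/measurable_EFinP/measurable_funM; first exact: measurable_indic.
  exact: measurable_funM.
transitivity (\int[mu]_y (h y * (F' y)%:E)).
  rewrite integral_mkcond; apply: eq_integral => y _.
  rewrite patchE /h indicE -EFinM; case: ifPn => _; last by rewrite !mul0r.
  by rewrite mul1r divfK// gt_eqF.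
rewrite ge0_integral_increasing_inverse// integral_mkcond [RHS]integral_mkcond.
apply: eq_integral => u _; rewrite !patchE /increasing_image_density.
case: ifPn => [/set_mem ru|nru]; last first.
  by rewrite indicE (negbTE nru) mul0r; case: ifPn.
rewrite /h !indicE (mem_set ru) mul1r.
have -> : (k u \in F @^-1` A) = (u \in A).
  by apply/idP/idP => /set_mem/= H; apply/mem_set => /=; move: H; rewrite Kk.
by case: ifPn => _; rewrite ?mul1r ?mul0r.
Qed.

End increasing_substitution.

(** * Expectations of functions of a variable with a density *)

Section expectation_of_density.
Context d (T : measurableType d) (R : realType) (P : probability T R).
Local Notation mu := (@lebesgue_measure R).
Variables (Z : T -> R) (p : R -> R).
Hypotheses (mZ : measurable_fun setT Z) (Zp : is_density P Z p).

Lemma ge0_expectation_density (h : R -> \bar R) : measurable_fun setT h ->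
  (forall x, 0 <= h x) -> \int[P]_w h (Z w) = \int[mu]_x (h x * (p x)%:E).
Proof.
case: Zp => mp [p0 Pp] mh h0.
have mZ' : measurable_fun setT (Z : T -> measurableTypeR R) by [].
rewrite -(@ge0_integral_density _ _ _ mu (pushforward P (Z : T -> measurableTypeR R)) p)//.
by rewrite ge0_integral_pushforward.
Qed.

(** The factor [p] is nonnegative, so it passes through positive and negative parts. No
    integrability is assumed: both sides follow the same convention for [oo - oo]. *)
Lemma expectation_density (h : R -> R) : measurable_fun setT h ->
  \int[P]_w (h (Z w))%:E = \int[mu]_x (p x * h x)%:E.
Proof.
move=> mh; have [mp [p0 Pp]] := Zp.
rewrite integralE [RHS]integralE.
have Epos (x : R) : ((fun x => (p x * h x)%:E)^\+)%E x = ((EFin \o h)^\+ x * (p x)%:E)%E.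
  by rewrite !funeposE /= -!EFin_max -EFinM maxr_pMl// mul0r mulrC.
have Eneg (x : R) : ((fun x => (p x * h x)%:E)^\-)%E x = ((EFin \o h)^\- x * (p x)%:E)%E.
  by rewrite !funenegE /= -!EFin_max -EFinM maxr_pMl// mul0r mulrC mulNr.
under [X in _ = X - _]eq_integral do rewrite Epos.
under [X in _ = _ - X]eq_integral do rewrite Eneg.
rewrite -!ge0_expectation_density//.
- by congr (_ - _); apply: eq_integral => w _; rewrite ?funeposE ?funenegE.
- apply: measurable_funeneg; exact/measurable_EFinP.
- apply: measurable_funepos; exact/measurable_EFinP.
Qed.

Lemma integrable_expectation_density (h : R -> R) : measurable_fun setT h ->
  mu.-integrable setT (fun x => (p x * h x)%:E) ->
  P.-integrable setT (fun w => (h (Z w))%:E).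
Proof.
move=> mh /integrableP[_ hoo]; apply/integrableP; split.
  exact/measurable_EFinP/measurableT_comp.
rewrite (ge0_expectation_density (h := fun x => `|(h x)%:E|))//.
  apply: le_lt_trans hoo; rewrite le_eqVlt; apply/orP; left; apply/eqP.
  apply: eq_integral => x _ /=; rewrite -EFinM normrM mulrC.
  by rewrite (ger0_norm (_ : 0 <= p x)%R)//; case: Zp => _ [].
by apply: measurableT_comp => //; exact/measurable_EFinP.
Qed.

(** Puts all entropies on the same probability space, where pointwise inequalities between
    logarithms can be integrated. *)
Lemma entropyE : entropy p = - \int[P]_w (ln (p (Z w)))%:E.
Proof.
rewrite /entropy (expectation_density (h := fun x => ln (p x)))//.
by apply: measurableT_comp => //; case: Zp.
Qed.

End expectation_of_density.

(** * The joint law of the input and the output *)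

Section joint_law.
Context d (T : measurableType d) (R : realType) (P : probability T R).
Local Notation mu := (@lebesgue_measure R).
Local Notation mR := (measurableTypeR R).
Variables (X W : T -> R) (sigma : R).
Hypotheses (mX : measurable_fun setT X) (mW : measurable_fun setT W).
Hypothesis lawW : forall A : set R, measurable A -> P (W @^-1` A) = normal_prob 0 sigma A.
Hypothesis XW : indep2 P X W.
Local Notation phi := (normal_pdf 0 sigma).

Let X_mixin := @isMeasurableFun.Build _ _ T mR X mX.
Let X_mfun : {mfun T >-> mR} := HB.pack (X : T -> mR) X_mixin.

Lemma ge0_expectation_indep (h : mR * mR -> \bar R) : measurable_fun setT h ->
  (forall z, 0 <= h z) ->
  \int[P]_w h (X w, W w) = \int[P]_w \int[mu]_z (h (X w, z) * (phi z)%:E).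
Proof.
move=> mh h0.
have mXW : measurable_fun setT (fun w => (X w : mR, W w : mR)) by exact: measurable_fun_pair.
have -> : \int[P]_w h (X w, W w) = \int[pushforward P (fun w => (X w : mR, W w : mR))]_z h z.
  by rewrite ge0_integral_pushforward.
have mh2 z : measurable_fun setT (fun y => h (z, y)) by exact: measurableT_comp.
transitivity (\int[distribution P X_mfun \x normal_prob 0 sigma]_z h z).
  apply: eq_measure_integral => A mA _; apply/esym.
  apply: (@product_measure_unique _ _ mR mR R (distribution P X_mfun)
    (normal_prob 0 sigma) (pushforward P (fun w => (X w : mR, W w : mR)))) => // B C mB mC.
  by rewrite [RHS]/= -lawW// -XW.
rewrite fubini_tonelli1// ge0_integral_distribution//; last first.
- by move=> x; exact: integral_ge0.
- exact: measurable_fun_fubini_tonelli_F.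
apply: eq_integral => w _ /=; rewrite /fubini_F.
rewrite (@ge0_integral_density _ _ _ mu _ phi)//.
- exact: measurable_normal_pdf.
- by move=> x; exact: normal_pdf_ge0.
Qed.

(** Bayes' rule in integrated form, valid for any law of [X]: [phi (y - X)] is the likelihood of the
    output [y], and Tonelli puts the integral over [y] outside, leaving an expectation at a fixed
    output. *)
Lemma ge0_expectation_sum_indep (h : mR -> mR -> \bar R) :
  measurable_fun setT (fun z => h z.1 z.2) -> (forall x y, 0 <= h x y) ->
  \int[P]_w h (X w) (X w + W w)%R =
  \int[mu]_y \int[P]_w (h (X w) y * (phi (y - X w))%:E).
Proof.
move=> mh h0.
have mh' : measurable_fun setT (fun z : mR * mR => h z.1 (z.1 + z.2)%R).
  apply: (@measurableT_comp _ _ _ _ _ _ (fun z : mR * mR => h z.1 z.2) _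
    (fun z : mR * mR => (z.1, z.1 + z.2)%R)) => //.
  by apply: measurable_fun_pair => //; exact: measurable_funD.
rewrite (ge0_expectation_indep (h := fun z => h z.1 (z.1 + z.2)%R))//=.
pose G (z : T * mR) : \bar R := h (X z.1) z.2 * (phi (z.2 - X z.1))%:E.
have mX1 : measurable_fun setT (fun z : T * mR => X z.1) by exact: measurableT_comp.
have mphi := @measurable_normal_pdf R 0 sigma.
have mG : measurable_fun setT G.
  apply: emeasurable_funM.
    apply: (@measurableT_comp _ _ _ _ _ _ (fun z : mR * mR => h z.1 z.2) _
      (fun z : T * mR => (X z.1 : mR, z.2))) => //.
    exact: measurable_fun_pair.
  apply/measurable_EFinP.
  by apply: (@measurableT_comp _ _ _ _ _ _ phi) => //; exact: measurable_funB.
have G0 z : 0 <= G z by rewrite mule_ge0// lee_fin normal_pdf_ge0.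
rewrite -(fubini_tonelli G mG G0).
apply: eq_integral => w _.
have mGw : measurable_fun setT (fun y : R => G (w, y)).
  apply: (@measurableT_comp _ _ _ _ _ _ G _ (fun y : mR => (w, y))) => //.
  exact: measurable_fun_pair.
(* Translation by [X w] turns the integral over the output into one over the noise. *)
have <- := ge0_integral_translation (X w) mGw (fun y => G0 (w, y)).
by apply: eq_integral => z _; rewrite /G/= addrAC subrr add0r.
Qed.

End joint_law.

(** * Smoothing by a bounded kernel, and differentiation under the expectation *)

Section convolution_kernel.
Context d (T : measurableType d) (R : realType) (P : probability T R).
Variables (X : T -> R) (mX : measurable_fun setT X).

(** Weight and kernel stay general because [phi] and its derivative both occur as [h], with the
    powers of [X] as weights. *)
Definition smoothing (Z : T -> R) (h : R -> R) (y : R) : R :=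
  (\int[P]_w (Z w * h (y - X w)))%R.

Lemma integrable_smoothing (Z : T -> R) (h : R -> R) (C : R) (y : R) :
  P.-integrable setT (EFin \o Z) -> measurable_fun setT h ->
  (forall z, `|h z| <= C)%R -> P.-integrable setT (fun w => (Z w * h (y - X w))%:E).
Proof.
move=> iZ mh hC; have mZ : measurable_fun setT Z by apply/measurable_EFinP; case/integrableP : iZ.
apply: (le_integrable measurableT _ _ (integrableZl measurableT C iZ)).
  apply/measurable_EFinP; apply: measurable_funM => //.
  by apply: (@measurableT_comp _ _ _ _ _ _ h) => //; exact: measurable_funB.
move=> w _ /=; rewrite -?EFinM lee_fin !normrM mulrC ler_wpM2r//.
by rewrite (le_trans (hC _))// ler_norm.
Qed.

Lemma continuous_smoothing (Z : T -> R) (h : R -> R) (C : R) :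
  P.-integrable setT (EFin \o Z) -> continuous h ->
  (forall z, `|h z| <= C)%R -> continuous (smoothing Z h).
Proof.
move=> iZ ch hC a; have mh := continuous_measurable_fun ch.
have iCZ : P.-integrable setT (EFin \o (fun w => C * `|Z w|)%R).
  have := integrableZl measurableT C (integrable_norm iZ).
  by apply: eq_integrable => // w _.
apply: (@continuity_under_integral R _ T P (fun y w => Z w * h (y - X w))%R setT
  measurableT (a - 1)%R (a + 1)%R _ _ (fun w => C * `|Z w|)%R) => //.
- by move=> y _; exact: integrable_smoothing.
- apply: aeW => w _ y _; apply: (@cvgM _ _ _ _ _ _ _ _ _); first exact: cvg_cst.
  apply: (@cvg_comp _ _ _ (fun y => y - X w)%R h); last exact: ch.
  by apply: cvgB; [exact: cvg_id|exact: cvg_cst].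
- move=> y _; apply: aeW => w _; rewrite normrM mulrC ler_wpM2r//.
- by rewrite inE/= in_itv/=; apply/andP; split; lra.
Qed.

(** The bound on [h'] is uniform, so [C' * |Z|] dominates the partial derivatives on any interval
    around [a]; the width 1 is arbitrary. *)
Lemma is_derive_smoothing (Z : T -> R) (h h' : R -> R) (C C' : R) (a : R) :
  P.-integrable setT (EFin \o Z) ->
  (forall z : R, is_derive z 1%R h (h' z)) ->
  (forall z, `|h z| <= C)%R -> (forall z, `|h' z| <= C')%R ->
  is_derive a 1%R (smoothing Z h) (smoothing Z h' a).
Proof.
move=> iZ dh hC hC'.
have ch : continuous h.
  by move=> y; apply/differentiable_continuous/derivable1_diffP; have [] := dh y.
have mh := continuous_measurable_fun ch.
have C'0 : (0 <= C')%R by apply: le_trans (hC' 0%R).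
have iCZ : P.-integrable setT (EFin \o (fun w => C' * `|Z w|)%R).
  have := integrableZl measurableT C' (integrable_norm iZ).
  by apply: eq_integrable => // w _.
pose f y w : R := (Z w * h (y - X w))%R.
have df w (y : R) : is_derive y 1%R (f ^~ w) (Z w * h' (y - X w))%R.
  have := dh (y - X w)%R => dhy.
  have dXy : is_derive y 1%R (fun y => y - X w)%R 1%R.
    by apply: is_derive_eq; rewrite subr0.
  have dhc := @is_derive1_comp _ h (fun y => y - X w)%R y _ _ dhy dXy.
  rewrite /f; apply: is_derive_eq; rewrite /GRing.scale/= ?mulr0 ?add0r ?addr0 ?mulr1 ?mul1r//.
have Ia : [set` `](a - 1)%R, (a + 1)%R[] a.
  by rewrite /= in_itv/=; apply/andP; split; lra.
have If x : [set` `](a - 1)%R, (a + 1)%R[] x -> P.-integrable setT (EFin \o f x).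
  by move=> _; exact: integrable_smoothing.
have df1 x w : [set` `](a - 1)%R, (a + 1)%R[] x -> setT w -> derivable (f ^~ w) x 1.
  by move=> _ _; have [] := df w x.
have dfE x w : partial1of2 f x w = (Z w * h' (x - X w))%R.
  by rewrite partial1of2E; have [_ ->] := df w x.
have dfG x w : [set` `](a - 1)%R, (a + 1)%R[] x -> setT w -> (`|partial1of2 f x w| <= C' * `|Z w|)%R.
  by move=> _ _; rewrite dfE normrM mulrC ler_wpM2r.
have G0 w : (0 <= C' * `|Z w|)%R by rewrite mulr_ge0.
apply: DeriveDef.
  exact: (derivable_under_integral measurableT Ia If df1 G0 iCZ dfG).
rewrite -derive1E (differentiation_under_integral measurableT Ia If df1 G0 iCZ dfG).
by apply: eq_Rintegral => w _; rewrite dfE.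
Qed.

End convolution_kernel.

(** * Derivative and bounds of the Gaussian density *)

Section gaussian_density.
Context {R : realType}.
Variable sigma : R.
Hypothesis sigma0 : (0 < sigma)%R.
Local Notation phi := (normal_pdf 0%R sigma).
Local Notation peak := (normal_peak sigma).
Local Open Scope ring_scope.

Lemma normal_pdfE0 z : phi z = peak * expR (- z ^+ 2 / (sigma ^+ 2 *+ 2)).
Proof. by rewrite normal_pdfE ?gt_eqF// /normal_fun subr0. Qed.

Lemma normal_pdf_gt0 m z : 0 < normal_pdf m sigma z.
Proof. by rewrite normal_pdfE ?gt_eqF// mulr_gt0 ?expR_gt0// normal_peak_gt0// gt_eqF. Qed.

Lemma normr_normal_pdf_ub z : `|phi z| <= peak.
Proof. by rewrite ger0_norm ?normal_pdf_ge0// normal_pdf_ub// gt_eqF. Qed.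

Lemma is_derive_normal_pdf (z : R) :
  is_derive z 1 phi (- z / sigma ^+ 2 * phi z).
Proof.
rewrite [X in is_derive _ _ X _](_ : _ = fun z => peak * expR (- z ^+ 2 / (sigma ^+ 2 *+ 2))); last first.
  by apply/funext => x; rewrite normal_pdfE0.
rewrite normal_pdfE0; set c := (sigma ^+ 2 *+ 2).
have dq : is_derive z 1 (fun z => - z ^+ 2 / c) (- (2 * z) / c).
  rewrite [X in is_derive _ _ X _](_ : _ = (- c^-1) *: (fun z : R => z ^+ 2)); last first.
    apply/funext => x; transitivity (- c^-1 * x ^+ 2); last by [].
    by rewrite mulNr mulNr mulrC.
  apply: is_derive_eq; rewrite /GRing.scale/= ?expr1 ?mulr1.
  by rewrite mulNr mulrC mulNr mulr_natl.
have de := @is_derive1_comp _ expR (fun z => - z ^+ 2 / c) z _ _ (is_derive_expR _) dq.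
rewrite [X in is_derive _ _ X _](_ : _ = peak *: (expR \o (fun z => - z ^+ 2 / c))) //.
apply: is_derive_eq; rewrite /GRing.scale/= /c.
by field; rewrite gt_eqF.
Qed.

(** Supplies the uniform bound on the derivative of [phi]. With [a = z^2 / (2 sigma^2)], one has
    [|z| <= 1/2 + z^2 / 2 = 1/2 + sigma^2 a], and both [exp (- a)] and [a exp (- a)] are at most
    1. *)
Lemma normr_id_normal_pdf_ub z : `|z * phi z| <= peak * (2^-1 + sigma ^+ 2).
Proof.
have peak0 := normal_peak_ge0 sigma.
have s0 : 0 < sigma ^+ 2 by rewrite exprn_gt0.
rewrite normrM (ger0_norm (normal_pdf_ge0 _ _ _)) normal_pdfE0 mulrCA ler_wpM2l//.
set a := z ^+ 2 / (sigma ^+ 2 *+ 2).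
have a0 : 0 <= a by rewrite divr_ge0 ?sqr_ge0 ?mulrn_wge0 ?sqr_ge0.
have za : `|z| <= 2^-1 + sigma ^+ 2 * a.
  have -> : sigma ^+ 2 * a = z ^+ 2 / 2 by rewrite /a; field; rewrite gt_eqF.
  rewrite -(real_normK (num_real z)); have := sqr_ge0 (`|z| - 1).
  by rewrite sqrrB1 => ?; lra.
have -> : - z ^+ 2 / (sigma ^+ 2 *+ 2) = - a by rewrite mulNr.
have ea0 := expR_gt0 (- a).
have ea1 : expR (- a) <= 1 by rewrite -[leRHS]expR0 ler_expR oppr_le0.
have aea : a * expR (- a) <= 1.
  rewrite expRN ler_pdivrMr ?expR_gt0// mul1r.
  by rewrite (le_trans _ (expR_ge1Dx a))// lerDr.
apply: (@le_trans _ _ ((2^-1 + sigma ^+ 2 * a) * expR (- a))).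
  by rewrite ler_wpM2r// ltW.
rewrite mulrDl lerD//; first by rewrite ler_piMr.
by rewrite -mulrA ler_piMr// ltW.
Qed.

End gaussian_density.

Lemma measurable_fun_inv_gt0 d (T : measurableType d) (R : realType) (f : T -> R) :
  measurable_fun setT f -> (forall x, (0 < f x)%R) ->
  measurable_fun setT (fun x => (f x)^-1)%R.
Proof.
move=> mf f0; have -> : (fun x => (f x)^-1)%R = (fun x => expR (- ln (f x)))%R.
  by apply/funext => x; rewrite expRN lnK ?posrE.
apply: measurableT_comp => //; apply: measurableT_comp => //.
exact: measurableT_comp.
Qed.

(** * Ratios of densities, evaluated along a random variable *)

Section density_ratio.
Context d (T : measurableType d) (R : realType) (P : probability T R).
Local Notation mu := (@lebesgue_measure R).
Variables (Z : T -> R) (p : R -> R).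
Hypotheses (mZ : measurable_fun setT Z) (Zp : is_density P Z p).
Hypothesis p_gt0 : forall x, (0 < p x)%R.

(** The density of the law cancels the denominator, so the ratio has mean 1 when [N] is a
    probability density. *)
Lemma expectation_density_ratio (N : R -> R) : measurable_fun setT N ->
  (forall x, (0 <= N x)%R) ->
  \int[P]_w (N (Z w) / p (Z w))%:E = \int[mu]_x (N x)%:E.
Proof.
move=> mN N0; have mp : measurable_fun setT p by case: Zp.
rewrite (ge0_expectation_density mZ Zp (h := fun x => (N x / p x)%:E))//.
- by apply: eq_integral => x _; rewrite -EFinM divfK// gt_eqF.
- by apply/measurable_EFinP; apply: measurable_funM => //; exact: measurable_fun_inv_gt0.
- by move=> x; rewrite lee_fin divr_ge0// ltW.
Qed.

Lemma integrable_density_ratio (N : R -> R) : measurable_fun setT N ->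
  (forall x, (0 <= N x)%R) -> \int[mu]_x (N x)%:E = 1 ->
  P.-integrable setT (fun w => (N (Z w) / p (Z w))%:E).
Proof.
move=> mN N0 N1; have mp : measurable_fun setT p by case: Zp.
apply/integrableP; split.
  apply/measurable_EFinP; apply: (@measurableT_comp _ _ _ _ _ _ (fun x => N x / p x)%R) => //.
  by apply: measurable_funM => //; exact: measurable_fun_inv_gt0.
rewrite (eq_integral (fun w => (N (Z w) / p (Z w))%:E)); last first.
  by move=> w _ /=; rewrite ger0_norm// divr_ge0// ltW.
by rewrite expectation_density_ratio// N1 ltry.
Qed.

End density_ratio.

(** * The second moment of the Gaussian noise *)

Section normal_second_moment.
Context d (T : measurableType d) (R : realType) (P : probability T R).
Variables (W : T -> R) (sigma : R).
Hypothesis mW : measurable_fun setT W.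
Hypothesis lawW : forall A : set R, measurable A -> P (W @^-1` A) = normal_prob 0 sigma A.
Hypothesis sigma0 : (0 < sigma)%R.
Local Notation phi := (normal_pdf 0%R sigma).

Lemma normal_is_density : is_density P W phi.
Proof.
split; first exact: measurable_normal_pdf.
by split => //; exact: normal_pdf_ge0.
Qed.

Let b w : R := (W w ^+ 2 / (sigma ^+ 2 *+ 2))%R.
(** The density ratio of [N(0, (sigma / r)^2)] to the law of [W]: it has mean 1, and convexity of
    the exponential bounds it below by an affine function of [b]. Taking [r < 1] controls [b] from
    above, taking [r > 1] controls its mean from below. *)
Let t (r : R) w : R := (normal_pdf 0 (sigma / r) (W w) / phi (W w))%R.

Let tE r w : (0 < r)%R -> t r w = (r * expR (- (r ^+ 2 - 1) * b w))%R.
Proof.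
move=> r0; rewrite /t !normal_pdfE0 ?divr_gt0//.
have s0 : sigma != 0%R by rewrite gt_eqF.
have rn0 : r != 0%R by rewrite gt_eqF.
have pE : normal_peak (sigma / r) = (r * normal_peak sigma)%R.
  rewrite /normal_peak.
  have -> : ((sigma / r) ^+ 2 * pi *+ 2 = r^-1 ^+ 2 * (sigma ^+ 2 * pi *+ 2))%R.
    by rewrite exprMn; ring.
  by rewrite sqrtrM ?sqr_ge0// sqrtr_sqr ger0_norm ?invr_ge0 ?ltW// invfM invrK.
have peak0 : normal_peak sigma != 0%R by rewrite gt_eqF// normal_peak_gt0.
rewrite pE invfM -expRN.
rewrite (_ : forall r q x y : R, q != 0 -> r * q * x * (q^-1 * y) = r * (x * y))%R//; last first.
  by move=> *; field.
rewrite -expRD; congr (_ * expR _)%R; rewrite /b.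
by field; rewrite s0.
Qed.

Let t_ge r w : (0 < r)%R -> (r * (1 - (r ^+ 2 - 1) * b w) <= t r w)%R.
Proof.
move=> r0; rewrite tE// ler_pM2l//.
by rewrite (le_trans _ (expR_ge1Dx _))// mulNr.
Qed.

Let it r : (0 < r)%R -> P.-integrable setT (fun w => (t r w)%:E).
Proof.
move=> r0; apply: (integrable_density_ratio mW normal_is_density) => //.
- by move=> x; exact: normal_pdf_gt0.
- exact: measurable_normal_pdf.
- by move=> x; exact: normal_pdf_ge0.
- exact: integral_normal_pdf.
Qed.

Let Et r : (0 < r)%R -> \int[P]_w (t r w)%:E = 1.
Proof.
move=> r0; rewrite (expectation_density_ratio mW normal_is_density)//.
- exact: integral_normal_pdf.
- by move=> x; exact: normal_pdf_gt0.
- exact: measurable_normal_pdf.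
- by move=> x; exact: normal_pdf_ge0.
Qed.

Let b0 w : (0 <= b w)%R.
Proof. by rewrite divr_ge0 ?sqr_ge0 ?mulrn_wge0 ?sqr_ge0. Qed.

Let ib : P.-integrable setT (fun w => (b w)%:E).
Proof.
(* At [r = 1/2], [t_ge] reads [1/2 + 3/8 b <= t r], whence [b <= 8/3 t r]. *)
have h0 : (0 < 2^-1 :> R)%R by rewrite invr_gt0.
apply: (le_integrable measurableT _ _ (integrableZl measurableT (8 / 3)%R (it h0))).
  apply/measurable_EFinP; apply: measurable_funM => //.
  exact: measurable_funX.
move=> w _ /=; rewrite lee_fin ger0_norm// (le_trans _ (ler_norm _))//.
have := t_ge w h0; lra.
Qed.

Lemma integrable_normal_sqr : P.-integrable setT (fun w => (W w ^+ 2)%:E).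
Proof.
have := integrableZl measurableT (sigma ^+ 2 *+ 2)%R ib.
apply: eq_integrable => // w _; rewrite -EFinM /b; congr (_%:E).
by field; rewrite gt_eqF.
Qed.

(* Comparing the densities of N(0, s^2) and N(0, (s/r)^2) gives [r (r + 1) E b >= 1] for all [r > 1]. *)
Lemma normal_second_moment_ge :
  1 <= \int[P]_w (W w ^+ 2 / sigma ^+ 2)%:E.
Proof.
have -> : \int[P]_w (W w ^+ 2 / sigma ^+ 2)%:E = 2%:E * \int[P]_w (b w)%:E.
  rewrite -integralZl//; apply: eq_integral => w _; rewrite -EFinM /b; congr (_%:E).
  by field; rewrite gt_eqF.
have /fineK : \int[P]_w (b w)%:E \is a fin_num by exact: integrable_fin_num.
set B := fine _ => BE; rewrite -BE -EFinM lee_fin.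
have B0 : (0 <= B)%R by rewrite /B fine_ge0// integral_ge0// => w _; rewrite lee_fin.
rewrite leNgt; apply/negP => B1.
(* For [r = 1 + e] the mean of the affine bound gives [(1 + e) (2 + e) B >= 1]. The choice
   [2 B = 1 - 8 e] contradicts this, since [(1 + e) (2 + e) / 2 = 1 + 3/2 e + e^2 / 2] gains too
   little to offset the factor [1 - 8 e]. *)
pose e := ((1 - 2 * B) / 8)%R; pose r : R := (1 + e)%R.
have r0 : (0 < r)%R by rewrite /r /e; lra.
have : (r * (1 - (r ^+ 2 - 1) * B) <= 1)%R.
  rewrite -lee_fin -(Et r0).
  have -> : (r * (1 - (r ^+ 2 - 1) * B))%:E =
      \int[P]_w (r * (1 - (r ^+ 2 - 1) * b w))%:E.
    under [RHS]eq_integral do rewrite mulrBr mulr1 mulrA EFinB EFinM.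
    rewrite integralB//; last 2 first.
    - exact: finite_measure_integrable_cst.
    - exact: integrableZl.
    rewrite integral_cst// [X in _ * X - _]probability_setT mule1 integralZl// -BE -EFinM -EFinB.
    by rewrite mulrBr mulr1 mulrA.
  apply: le_integral => //; last by move=> w _; rewrite lee_fin; exact: t_ge.
  - under eq_fun do rewrite mulrBr mulr1 mulrA EFinB EFinM.
    apply: integrableB => //; first exact: finite_measure_integrable_cst.
    exact: integrableZl.
  - exact: it.
rewrite /r; have e0 : (0 < e)%R by rewrite /e; lra.
have e1 : (e <= 1)%R by rewrite /e; lra.
have Be : (B = (1 - 8 * e) / 2)%R by rewrite /e; lra.
rewrite Be; nra.
Qed.

End normal_second_moment.

(** Were the integral zero, [f] would vanish almost everywhere, and the whole space would be
    null. *)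
Lemma integral_gt0 d (T : measurableType d) (R : realType) (P : probability T R)
    (f : T -> R) : measurable_fun setT f -> (forall w, (0 <= f w)%R) ->
  P [set w | f w = 0%R] = 0 -> 0 < \int[P]_w (f w)%:E.
Proof.
move=> mf f0 Pf0; rewrite lt_neqAle integral_ge0 ?andbT; last first.
  by move=> w _; rewrite lee_fin.
apply/eqP => int0.
have /ae_eq_integral_abs : measurable_fun setT (EFin \o f) by exact/measurable_EFinP.
move=> /(_ P measurableT)[+ _].
have -> : \int[P]_x `|(EFin \o f) x| = 0.
  by rewrite int0; apply: eq_integral => w _ /=; rewrite ger0_norm.
move=> /(_ erefl)[N [mN PN0 Nsub]].
have mf0 : measurable [set w | f w = 0%R].
  by rewrite -[X in measurable X]setTI; exact: (mf measurableT [set 0%R]).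
suff : P setT <= 0 by rewrite [X in X <= _]probability_setT lee_fin ler10.
have -> : [set: T] = [set w | f w = 0%R] `|` N.
  apply/seteqP; split => // w _; have [fw|fw] := pselect (f w = 0%R); first by left.
  by right; apply: Nsub => /(_ I) /= [].
apply: (le_trans (measureU2 _ mf0 mN)).
by rewrite [X in X + _ <= _](Pf0) add0e [leLHS]PN0.
Qed.

(** * Posterior mean and variance as smooth functions of the output *)

Section posterior.
Context d (T : measurableType d) (R : realType) (P : probability T R).
Variables (X : T -> R) (sigma : R).
Hypothesis mX : measurable_fun setT X.
Hypothesis iX2 : P.-integrable setT (fun w => (X w ^+ 2)%:E).
Hypothesis sigma0 : (0 < sigma)%R.
Local Notation phi := (normal_pdf 0%R sigma).
Local Open Scope ring_scope.

Definition weighted_moment (k : nat) : R -> R :=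
  smoothing P X (fun w => X w ^+ k) phi.
Local Notation F := weighted_moment.

Definition post_mean y := F 1 y / F 0 y.
Definition post_var y := F 2 y / F 0 y - post_mean y ^+ 2.

Lemma integrable_moment k : (k <= 2)%N -> P.-integrable setT (EFin \o (fun w => X w ^+ k)).
Proof.
move=> k2; apply: (le_integrable measurableT _ _
  (integrableD measurableT (finite_measure_integrable_cst P 1 measurableT) iX2)).
  by apply/measurable_EFinP; exact: measurable_funX.
move=> w _ /=; rewrite lee_fin [leRHS]ger0_norm ?addr_ge0 ?sqr_ge0// normrX.
have := normr_ge0 (X w); rewrite -(real_normK (num_real (X w))).
by case: k k2 => [|[|[|//]]] _ ?; nra.
Qed.

Lemma integrable_weighted_moment k y : (k <= 2)%N ->
  P.-integrable setT (fun w => (X w ^+ k * phi (y - X w))%:E).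
Proof.
move=> k2; apply: (integrable_smoothing mX (C := normal_peak sigma)).
- exact: integrable_moment.
- exact: measurable_normal_pdf.
- exact: normr_normal_pdf_ub.
Qed.

Lemma continuous_weighted_moment k : (k <= 2)%N -> continuous (F k).
Proof.
move=> k2; apply: (continuous_smoothing mX (C := normal_peak sigma)).
- exact: integrable_moment.
- by apply: continuous_normal_pdf; rewrite gt_eqF.
- exact: normr_normal_pdf_ub.
Qed.

(** [phi' z = - z / sigma^2 * phi z] at [z = y - X] produces the factor [X - y], so a derivative
    costs one moment; with second moments available this allows [k <= 1]. *)
Lemma is_derive_weighted_moment k (y : R) : (k <= 1)%N ->
  is_derive y 1 (F k) ((F k.+1 y - y * F k y) / sigma ^+ 2).
Proof.
move=> k1; have k2 : (k <= 2)%N by rewrite (leq_trans k1).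
have -> : (F k.+1 y - y * F k y) / sigma ^+ 2 =
    smoothing P X (fun w => X w ^+ k) (fun z => - z / sigma ^+ 2 * phi z) y.
  have i1 := @integrable_weighted_moment k.+1 y k1.
  have i0 := @integrable_weighted_moment k y k2.
  have i0' : P.-integrable setT (EFin \o (fun w => y * (X w ^+ k * phi (y - X w)))).
    by have := integrableZl measurableT y i0; apply: eq_integrable.
  rewrite /F /smoothing -RintegralZl// -RintegralB// -RintegralZr//; last first.
    by have := integrableB measurableT i1 i0'; apply: eq_integrable.
  by apply: eq_Rintegral => w _; rewrite exprS; ring.
apply: (is_derive_smoothing mX (C := normal_peak sigma)
  (C' := normal_peak sigma * (2^-1 + sigma ^+ 2) / sigma ^+ 2)) => //.
- exact: integrable_moment.
- exact: is_derive_normal_pdf.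
- exact: normr_normal_pdf_ub.
- move=> z; rewrite mulrAC mulNr normrM normrN normfV (ger0_norm (sqr_ge0 _)).
  by rewrite ler_wpM2r ?invr_ge0 ?sqr_ge0// normr_id_normal_pdf_ub.
Qed.

Lemma weighted_momentE k y : (k <= 2)%N ->
  (F k y)%:E = (\int[P]_w (X w ^+ k * phi (y - X w))%:E)%E.
Proof.
move=> k2; rewrite /F /smoothing /Rintegral fineK//.
exact/integrable_fin_num/integrable_weighted_moment.
Qed.

Lemma weighted_moment0E y : (F 0 y)%:E = (\int[P]_w (phi (y - X w))%:E)%E.
Proof.
by rewrite weighted_momentE//; apply: eq_integral => w _; rewrite expr0 mul1r.
Qed.

Lemma weighted_moment0_gt0 y : 0 < F 0 y.
Proof.
rewrite -lte_fin weighted_moment0E; apply: integral_gt0.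
- by apply: (@measurableT_comp _ _ _ _ _ _ phi);
    [exact: measurable_normal_pdf|exact: measurable_funB].
- by move=> w; exact: normal_pdf_ge0.
- rewrite (_ : [set _ | _] = set0) ?measure0//; apply/seteqP; split => // w /=.
  by apply/eqP; rewrite gt_eqF// normal_pdf_gt0.
Qed.

(** The definition as a difference of moments suits differentiation; this form, an expectation of a
    square, yields the sign and the link with the conditional variance. *)
Lemma post_varE y : (post_var y * F 0 y)%:E =
  (\int[P]_w ((X w - post_mean y) ^+ 2 * phi (y - X w))%:E)%E.
Proof.
have F0 := weighted_moment0_gt0 y; have F0n : F 0 y != 0 by rewrite gt_eqF.
have i0 := @integrable_weighted_moment 0 y isT.
have i1 := @integrable_weighted_moment 1 y isT.
have i2 := @integrable_weighted_moment 2 y isT.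
have i1' := integrableZl measurableT (2 * post_mean y) i1.
have i0' := integrableZl measurableT (post_mean y ^+ 2) i0.
transitivity ((F 2 y)%:E - (2 * post_mean y)%:E * (F 1 y)%:E + (post_mean y ^+ 2)%:E * (F 0 y)%:E)%E.
  rewrite -!EFinM -!EFinB -!EFinD; congr (_%:E).
  by rewrite /post_var /post_mean; field.
rewrite !weighted_momentE// -!integralZl// -integralB// -integralD//; last exact: integrableB.
by apply: eq_integral => w _; rewrite -!EFinM -!EFinB -!EFinD; congr (_%:E); ring.
Qed.

Lemma post_var_le y : post_var y * F 0 y <= F 2 y.
Proof.
have F0 := weighted_moment0_gt0 y.
by rewrite mulrBl divfK ?gt_eqF// lerBlDr lerDl mulr_ge0 ?sqr_ge0 ?ltW.
Qed.

Lemma continuous_post_mean : continuous post_mean.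
Proof.
move=> y; apply: cvgM; first exact: continuous_weighted_moment.
by apply: cvgV; [rewrite gt_eqF// weighted_moment0_gt0|exact: continuous_weighted_moment].
Qed.

Lemma continuous_post_var : continuous post_var.
Proof.
move=> y; apply: cvgB.
  apply: cvgM; first exact: continuous_weighted_moment.
  by apply: cvgV; [rewrite gt_eqF// weighted_moment0_gt0|exact: continuous_weighted_moment].
by apply: (@cvgM _ _ _ _ post_mean post_mean); exact: continuous_post_mean.
Qed.

(** In the quotient rule the two terms [y * F 0 y * F 1 y] cancel, leaving
    [(F 2 * F 0 - F 1^2) / (sigma^2 * F 0^2)]. *)
Lemma is_derive_post_mean (y : R) : is_derive y 1 post_mean (post_var y / sigma ^+ 2).
Proof.
have F0n : F 0 y != 0 by rewrite gt_eqF// weighted_moment0_gt0.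
have d0 := @is_derive_weighted_moment 0 y isT.
have d1 := @is_derive_weighted_moment 1 y isT.
have dV := is_deriveV F0n d0.
rewrite [X in is_derive _ _ X _](_ : _ = F 1 * (fun y => (F 0 y)^-1))//.
apply: is_derive_eq; rewrite /GRing.scale/= /post_var /post_mean.
by field; rewrite F0n gt_eqF.
Qed.

Hypothesis X0 : forall c, P (X @^-1` [set c]) = 0%E.

(** The kernel is positive, so the integrand of [post_varE] vanishes only where [X = post_mean y], a
    null event without atoms. This holds at every [y], as the substitution requires. *)
Lemma post_var_gt0 y : 0 < post_var y.
Proof.
have F0 := weighted_moment0_gt0 y.
rewrite -(pmulr_lgt0 _ F0) -lte_fin post_varE; apply: integral_gt0.
- apply: measurable_funM; first by apply: measurable_funX; exact: measurable_funB.
  by apply: (@measurableT_comp _ _ _ _ _ _ phi);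
    [exact: measurable_normal_pdf|exact: measurable_funB].
- by move=> w; rewrite mulr_ge0 ?sqr_ge0 ?normal_pdf_ge0.
- rewrite -[RHS](X0 (post_mean y)); congr (P _); apply/seteqP; split => w /=.
    move/eqP; rewrite mulf_eq0 (gt_eqF (normal_pdf_gt0 sigma0 _ _)) orbF.
    by rewrite sqrf_eq0 subr_eq0 => /eqP.
  by move=> ->; rewrite subrr expr0n/= mul0r.
Qed.

End posterior.

(** * Uniqueness of versions of a conditional expectation *)

Section conditional_expectation.
Context d (T : measurableType d) (R : realType) (P : probability T R).

(** Under the law of [Y], [g] and [g'] have the same integral over every Borel set, hence agree
    almost everywhere; the exceptional set is pulled back by [Y]. *)
Lemma cond_exp_fun_unique (Y Z : T -> R) (g g' : R -> R) : measurable_fun setT Y ->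
  cond_exp_fun P Y Z g -> cond_exp_fun P Y Z g' ->
  {ae P, forall w, g (Y w) = g' (Y w)}.
Proof.
move=> mY [mg [ig gE]] [mg' [ig' g'E]].
pose Y_mixin := isMeasurableFun.Build _ _ _ _ Y mY.
pose Y' : {mfun T >-> R} := HB.pack Y Y_mixin.
have [N [mN PN0 sub]] : ae_eq (distribution P Y') setT (EFin \o g) (EFin \o g').
  apply: integral_ae_eq => //.
  - by apply: integrable_pushforward => //; exact/measurable_EFinP.
  - exact/measurable_EFinP.
  move=> B _ mB.
  have mYB : measurable (Y @^-1` B) by rewrite -[X in measurable X]setTI; exact: (mY).
  rewrite !integral_pushforward//.
  - by rewrite -gE// g'E.
  - exact/measurable_EFinP.
  - exact: integrableS ig'.
  - exact/measurable_EFinP.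
  - exact: integrableS ig.
exists (Y @^-1` N); split.
- by rewrite -[X in measurable X]setTI; exact: (mY).
- exact: PN0.
- move=> w /= gg'; apply: sub => /= /(_ I) [] gg''; exact: gg'.
Qed.

(** Bridges the squares [(X - g Y)^2] and [(X - m Y)^2]: a given conditional variance is centred at
    a given version [g], the explicit one at the posterior mean. *)
Lemma eq_cond_exp_fun (Y Z Z' : T -> R) (g : R -> R) :
  measurable_fun setT Y -> measurable_fun setT Z -> measurable_fun setT Z' ->
  {ae P, forall w, Z w = Z' w} -> cond_exp_fun P Y Z g -> cond_exp_fun P Y Z' g.
Proof.
move=> mY mZ mZ' ZZ' [mg [ig gE]]; split => //; split => // B mB; rewrite -gE//.
have mYB : measurable (Y @^-1` B) by rewrite -[X in measurable X]setTI; exact: mY.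
apply: ae_eq_integral => //.
- exact/measurable_EFinP/measurable_funTS.
- exact/measurable_EFinP/measurable_funTS.
- by apply: filterS ZZ' => w -> .
Qed.

End conditional_expectation.

(** * Conditional mean and variance given the channel output *)

Section gaussian_channel.
Context d (T : measurableType d) (R : realType) (P : probability T R).
Local Notation mu := (@lebesgue_measure R).
Local Notation mR := (measurableTypeR R).
Variables (X W : T -> R) (sigma : R).
Hypotheses (mX : measurable_fun setT X) (mW : measurable_fun setT W).
Hypothesis iX2 : P.-integrable setT (fun w => (X w ^+ 2)%:E).
Hypothesis sigma0 : (0 < sigma)%R.
Hypothesis lawW : forall A : set R, measurable A -> P (W @^-1` A) = normal_prob 0 sigma A.
Hypothesis XW : indep2 P X W.
Local Notation phi := (normal_pdf 0%R sigma).
Local Notation Y := (fun w => X w + W w)%R.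
Local Notation F := (weighted_moment P X sigma).
Local Notation m := (post_mean P X sigma).
Local Notation V := (post_var P X sigma).

Let mY : measurable_fun setT Y. Proof. exact: measurable_funD. Qed.

Let mF k : (k <= 2)%N -> measurable_fun setT (F k).
Proof. by move=> k2; apply: continuous_measurable_fun; exact: continuous_weighted_moment. Qed.

Let F0_ge0 y : (0 <= F 0 y)%R. Proof. by rewrite ltW// weighted_moment0_gt0. Qed.

Lemma channel_output_density : is_density P Y (F 0).
Proof.
split; first exact: mF; split => // A mA.
have mYA : measurable (Y @^-1` A) by rewrite -[X in measurable X]setTI; exact: mY.
transitivity (\int[P]_w (\1_A (Y w))%:E).
  by rewrite -[RHS]/(\int[P]_w (\1_(Y @^-1` A) w)%:E) integral_indic// setIT.
rewrite (ge0_expectation_sum_indep mX mW lawW XW (h := fun x y => (\1_A y)%:E))//.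
- rewrite [RHS]integral_mkcond; apply: eq_integral => y _.
  rewrite ge0_integralZl//=; last first.
  - by move=> w _; rewrite lee_fin normal_pdf_ge0.
  - apply/measurable_EFinP; apply: (@measurableT_comp _ _ _ _ _ _ phi).
      exact: measurable_normal_pdf.
    exact: measurable_funB.
  rewrite -(weighted_moment0E mX iX2 sigma0) patchE indicE.
  by case: ifPn => _; rewrite ?mul1e ?mul0e.
- apply/measurable_EFinP.
  by apply: (@measurableT_comp _ _ _ _ _ _ (\1_A : mR -> R)).
Qed.

Lemma conditional_ge0 (u : R -> R -> R) (c : R -> R) :
  (forall x y, (0 <= u x y)%R) ->
  (forall y, \int[P]_w (u (X w) y * phi (y - X w))%:E = (c y * F 0 y)%:E) ->
  forall y, (0 <= c y)%R.
Proof.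
move=> u0 uc y; rewrite -(pmulr_lge0 _ (weighted_moment0_gt0 mX iX2 sigma0 y)).
rewrite -lee_fin -uc; apply: integral_ge0 => w _.
by rewrite lee_fin mulr_ge0// normal_pdf_ge0.
Qed.

(** Recognises [c (Y)] as the conditional expectation of [u (X, Y)] from a computation at fixed [y].
    Nonnegativity of [u] is what lets Tonelli exchange the integrals. *)
Lemma conditional_integral (u : mR -> mR -> R) (c : R -> R) (B : set R) :
  measurable_fun setT (fun z => u z.1 z.2) -> (forall x y, (0 <= u x y)%R) ->
  measurable_fun setT c ->
  (forall y, \int[P]_w (u (X w) y * phi (y - X w))%:E = (c y * F 0 y)%:E) ->
  measurable B ->
  \int[P]_(w in Y @^-1` B) (u (X w) (Y w))%:E = \int[P]_(w in Y @^-1` B) (c (Y w))%:E.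
Proof.
move=> mu0 u0 mc uc mB; have c0 := conditional_ge0 u0 uc.
have E (h : T -> \bar R) : \int[P]_(w in Y @^-1` B) h w = \int[P]_w ((\1_B (Y w))%:E * h w).
  rewrite integral_mkcond; apply: eq_integral => w _.
  rewrite patchE indicE; have -> : (w \in Y @^-1` B) = (Y w \in B) by apply/idP/idP => /set_mem /mem_set.
  by case: ifPn => _; rewrite ?mul1e ?mul0e.
rewrite 2!E.
rewrite (ge0_expectation_sum_indep mX mW lawW XW (h := fun x y => (\1_B y)%:E * (u x y)%:E)); last 2 first.
- apply: emeasurable_funM; apply/measurable_EFinP => //.
  by apply: (@measurableT_comp _ _ _ _ _ _ (\1_B : mR -> R)).
- by move=> x y; rewrite mule_ge0// lee_fin.
rewrite (ge0_expectation_density mY channel_output_density (h := fun y => (\1_B y)%:E * (c y)%:E)); last 2 first.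
- by apply: emeasurable_funM; exact/measurable_EFinP.
- by move=> y; rewrite mule_ge0// lee_fin.
apply: eq_integral => y _; rewrite -[RHS]muleA -(EFinM (c y)) -uc -ge0_integralZl//.
- by apply: eq_integral => w _; rewrite -muleA EFinM.
- apply/measurable_EFinP/measurable_funM.
    by apply: (@measurableT_comp _ _ _ _ _ _ (fun z : mR * mR => u z.1 z.2) _ (fun w => (X w : mR, y : mR))) => //;
      exact: measurable_fun_pair.
  apply: (@measurableT_comp _ _ _ _ _ _ phi); first exact: measurable_normal_pdf.
  exact: measurable_funB.
- by move=> w _; rewrite lee_fin mulr_ge0// normal_pdf_ge0.
Qed.

Lemma conditional_integrable (u : mR -> mR -> R) (c : R -> R) :
  measurable_fun setT (fun z => u z.1 z.2) -> (forall x y, (0 <= u x y)%R) ->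
  measurable_fun setT c ->
  (forall y, \int[P]_w (u (X w) y * phi (y - X w))%:E = (c y * F 0 y)%:E) ->
  P.-integrable setT (fun w => (u (X w) (Y w))%:E) ->
  P.-integrable setT (fun w => (c (Y w))%:E).
Proof.
move=> mu0 u0 mc uc /integrableP[_ uoo]; apply/integrableP; split.
  by apply/measurable_EFinP; exact: measurableT_comp.
have := conditional_integral mu0 u0 mc uc measurableT; rewrite preimage_setT => E.
rewrite (eq_integral (fun w => (c (Y w))%:E)).
  rewrite -E; apply: le_lt_trans uoo; rewrite le_eqVlt; apply/orP; left; apply/eqP.
  by apply: eq_integral => w _ /=; rewrite ger0_norm.
by move=> w _ /=; rewrite ger0_norm// (conditional_ge0 u0 uc).
Qed.

Let r2 y := (F 2 y / F 0 y)%R.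

Let mF0V : measurable_fun setT (fun y => (F 0 y)^-1)%R.
Proof. by apply: measurable_fun_inv_gt0 => //; [exact: mF|move=> y; exact: weighted_moment0_gt0]. Qed.

Let mr2 : measurable_fun setT r2. Proof. by apply: measurable_funM => //; exact: mF. Qed.

Lemma measurable_post_mean : measurable_fun setT m.
Proof. by apply: continuous_measurable_fun; exact: continuous_post_mean. Qed.

Lemma measurable_post_var : measurable_fun setT V.
Proof. by apply: continuous_measurable_fun; exact: continuous_post_var. Qed.

Let F0n y : F 0 y != 0%R. Proof. by rewrite gt_eqF// weighted_moment0_gt0. Qed.

Let sq_cond y : \int[P]_w ((X w) ^+ 2 * phi (y - X w))%:E = (r2 y * F 0 y)%:E.
Proof. by rewrite -weighted_momentE// divfK. Qed.

(** [X] is signed while [conditional_integral] takes nonnegative functions; hence the polarization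
    [x = ((x + 1)^2 - x^2 - 1) / 2], where [c1] and [r2] are the conditional expectations of the two
    squares. *)
Let u1 (x y : R) : R := ((x + 1) ^+ 2)%R.
Let c1 y : R := (r2 y + 2 * m y + 1)%R.

Let mc1 : measurable_fun setT c1.
Proof.
apply: measurable_funD => //; apply: measurable_funD => //.
by apply: measurable_funM => //; exact: measurable_post_mean.
Qed.

Let sq1_cond y : \int[P]_w (u1 (X w) y * phi (y - X w))%:E = (c1 y * F 0 y)%:E.
Proof.
have i k (k2 : (k <= 2)%N) := integrable_weighted_moment mX iX2 sigma0 y k2.
have i1' := integrableZl measurableT 2%R (i 1%N isT).
transitivity ((F 2 y)%:E + 2%:E * (F 1 y)%:E + (F 0 y)%:E).
  rewrite !weighted_momentE// -integralZl//; last exact: i.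
  rewrite -integralD//; last exact: i.
  rewrite -integralD//; [|by apply: integrableD => //; exact: i|exact: i].
  by apply: eq_integral => w _; rewrite -!EFinM -!EFinD /u1; congr (_%:E); ring.
by rewrite -!EFinM -!EFinD /c1 /r2 /post_mean; congr (_%:E); field.
Qed.

Let mu2 : measurable_fun setT (fun z : mR * mR => z.1 ^+ 2)%R.
Proof. exact: measurable_funX. Qed.

Let mu1 : measurable_fun setT (fun z : mR * mR => u1 z.1 z.2)%R.
Proof. by apply: measurable_funX; exact: measurable_funD. Qed.

Let iX : P.-integrable setT (fun w => (X w)%:E).
Proof. by have := integrable_moment mX iX2 (isT : (1 <= 2)%N); apply: eq_integrable => // w _ /=; rewrite expr1. Qed.

Let iu1 : P.-integrable setT (fun w => (u1 (X w) (Y w))%:E).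
Proof.
have i1' := integrableZl measurableT 2%R iX.
have := integrableD measurableT (integrableD measurableT iX2 i1')
  (finite_measure_integrable_cst P 1%R measurableT).
by apply: eq_integrable => // w _; rewrite /= /u1 -?EFinM -?EFinD; congr (_%:E); ring.
Qed.

Let ir2 : P.-integrable setT (fun w => (r2 (Y w))%:E).
Proof.
by apply: (conditional_integrable (u := fun x _ => x ^+ 2)%R) => // x y; exact: sqr_ge0.
Qed.

Let ic1 : P.-integrable setT (fun w => (c1 (Y w))%:E).
Proof.
by apply: (conditional_integrable mu1) => // x y; exact: sqr_ge0.
Qed.

Lemma cond_exp_post_mean : cond_exp_fun P Y X m.
Proof.
have D (a b e : T -> R) B : (forall w, e w = 2^-1 * (a w - b w - 1))%R ->
    measurable B -> P.-integrable setT (fun w => (a w)%:E) ->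
    P.-integrable setT (fun w => (b w)%:E) ->
    P.-integrable B (fun w => (e w)%:E) /\
    \int[P]_(w in B) (e w)%:E = (2^-1)%:E * (\int[P]_(w in B) (a w)%:E
      - \int[P]_(w in B) (b w)%:E - \int[P]_(w in B) 1%:E).
  move=> eE mB ia ib.
  have {}ia : P.-integrable B (fun w => (a w)%:E) by exact: integrableS ia.
  have {}ib : P.-integrable B (fun w => (b w)%:E) by exact: integrableS ib.
  have i1 : P.-integrable B (EFin \o cst 1%R) by exact: finite_measure_integrable_cst.
  have iab := integrableB mB (integrableB mB ia ib) i1.
  have -> : (fun w => (e w)%:E) = (fun w => (2^-1)%:E * (((a w)%:E - (b w)%:E) - 1%:E)).
    by apply/funext => w; rewrite eE -!EFinB -EFinM.
  split; first exact: integrableZl.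
  rewrite integralZl// integralB//; last exact: integrableB.
  by rewrite integralB.
have eX w : (X w = 2^-1 * (u1 (X w) (Y w) - X w ^+ 2 - 1))%R by rewrite /u1; field.
have em w : (m (Y w) = 2^-1 * (c1 (Y w) - r2 (Y w) - 1))%R by rewrite /c1; field.
split; first exact: measurable_post_mean.
split; first by case: (D _ _ _ setT em measurableT ic1 ir2).
move=> B mB; have mYB : measurable (Y @^-1` B) by rewrite -[X in measurable X]setTI; exact: mY.
have [_ ->] := D _ _ _ _ eX mYB iu1 iX2.
have [_ ->] := D _ _ _ _ em mYB ic1 ir2.
rewrite (conditional_integral mu1 _ mc1 sq1_cond mB); last by move=> x y; exact: sqr_ge0.
have u20 (x _ : mR) : (0 <= (x : R) ^+ 2)%R by exact: sqr_ge0.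
by rewrite (@conditional_integral (fun x _ => (x : R) ^+ 2)%R r2 B mu2 u20 mr2 sq_cond mB).
Qed.

Let uV (x y : R) : R := ((x - m y) ^+ 2)%R.

Let muV : measurable_fun setT (fun z : mR * mR => uV z.1 z.2).
Proof.
apply: measurable_funX; apply: measurable_funB; first exact: measurable_fst.
by apply: (@measurableT_comp _ _ _ _ _ _ m); first exact: measurable_post_mean.
Qed.

Let uV_cond y : \int[P]_w (uV (X w) y * phi (y - X w))%:E = (V y * F 0 y)%:E.
Proof. by rewrite post_varE. Qed.

Lemma integrable_post_var : P.-integrable setT (fun w => (V (Y w))%:E).
Proof.
have V0 : forall y, (0 <= V y)%R by apply: (conditional_ge0 (u := uV)) => // x y; exact: sqr_ge0.
apply: (le_integrable measurableT _ _ ir2).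
  by apply/measurable_EFinP; apply: measurableT_comp => //; exact: measurable_post_var.
move=> w _ /=; rewrite lee_fin ger0_norm// (le_trans _ (ler_norm _))//.
by rewrite /r2 ler_pdivlMr ?weighted_moment0_gt0// post_var_le.
Qed.

Lemma cond_exp_post_var : cond_exp_fun P Y (fun w => (X w - m (Y w)) ^+ 2)%R V.
Proof.
split; first exact: measurable_post_var.
split; first exact: integrable_post_var.
move=> B mB; apply: (conditional_integral muV _ measurable_post_var uV_cond mB).
by move=> x y; exact: sqr_ge0.
Qed.

Variables (g v : R -> R).
Hypothesis gP : cond_exp_fun P Y X g.
Hypothesis vP : cond_var_fun P Y X g v.

Lemma cond_exp_ae_post_mean : {ae P, forall w, g (Y w) = m (Y w)}.
Proof. exact: cond_exp_fun_unique cond_exp_post_mean. Qed.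

Lemma cond_var_ae_post_var : {ae P, forall w, v (Y w) = V (Y w)}.
Proof.
apply: (cond_exp_fun_unique mY vP).
have mg : measurable_fun setT g by case: gP.
apply: (eq_cond_exp_fun mY _ _ _ cond_exp_post_var).
- apply: measurable_funX; apply: measurable_funB; first exact: mX.
  by apply: (@measurableT_comp _ _ _ _ _ _ m); first exact: measurable_post_mean.
- by apply: measurable_funX; apply: measurable_funB => //; exact: measurableT_comp.
- by apply: filterS cond_exp_ae_post_mean => w ->.
Qed.

End gaussian_channel.

(** With the normalization inside the exponential, ratios of Gaussian densities become differences
    of exponents. *)
Lemma normal_pdf_expE (R : realType) (m s x : R) : (0 < s)%R ->
  normal_pdf m s x =
  expR (- (x - m) ^+ 2 / (s ^+ 2 * 2) - ln (s ^+ 2 * pi * 2) / 2)%R.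
Proof.
move=> s0; rewrite normal_pdfE ?gt_eqF// /normal_peak /normal_fun expRD mulrC.
rewrite -(mulr_natr (s ^+ 2)) -(mulr_natr (s ^+ 2 * pi)); congr (_ * _)%R.
set a := (s ^+ 2 * pi * 2)%R.
have a0 : (0 < a)%R by rewrite !mulr_gt0 ?pi_gt0 ?exprn_gt0.
have aE : a = (expR (ln a / 2) ^+ 2)%R by rewrite expr2 -expRD -splitr lnK.
by rewrite expRN [X in Num.sqrt X]aE sqrtr_sqr ger0_norm// expR_ge0.
Qed.

(** * Comparison with Gaussian posteriors and the entropy inequality *)

Section entropy_bound.
Context d (T : measurableType d) (R : realType) (P : probability T R).
Local Notation mu := (@lebesgue_measure R).
Local Notation mR := (measurableTypeR R).
Variables (X W : T -> R) (p : R -> R) (sigma : R).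
Hypotheses (mX : measurable_fun setT X) (mW : measurable_fun setT W).
Hypothesis iX2 : P.-integrable setT (fun w => (X w ^+ 2)%:E).
Hypothesis Xp : is_density P X p.
Hypothesis sigma0 : (0 < sigma)%R.
Hypothesis lawW : forall A : set R, measurable A -> P (W @^-1` A) = normal_prob 0 sigma A.
Hypothesis XW : indep2 P X W.
Local Notation phi := (normal_pdf 0%R sigma).
Local Notation Y := (fun w => X w + W w)%R.
Local Notation f := (weighted_moment P X sigma 0).
Local Notation m := (post_mean P X sigma).
Local Notation V := (post_var P X sigma).

Let mY : measurable_fun setT Y. Proof. exact: measurable_funD. Qed.

Lemma density_atomless (c : R) : P (X @^-1` [set c]) = 0.
Proof.
case: Xp => mp [p0 ->]; last exact: measurable_set1.
exact: integral_set1.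
Qed.

Let f0 y : (0 < f y)%R. Proof. exact: weighted_moment0_gt0. Qed.
Let V0 y : (0 < V y)%R. Proof. by apply: post_var_gt0 => // c; exact: density_atomless. Qed.
Let mf : measurable_fun setT f.
Proof. by case: (channel_output_density mX mW iX2 sigma0 lawW XW). Qed.
Let mp : measurable_fun setT p. Proof. by case: Xp. Qed.
Let p0 x : (0 <= p x)%R. Proof. by case: Xp => _ []. Qed.
Let mm : measurable_fun setT m. Proof. exact: measurable_post_mean. Qed.
Let mV : measurable_fun setT V. Proof. exact: measurable_post_var. Qed.

Lemma output_density_le y : (f y <= normal_peak sigma)%R.
Proof.
rewrite -lee_fin weighted_moment0E//.
rewrite -[leRHS]mule1 -(@probability_setT _ _ _ P) -integral_cst//.
apply: ge0_le_integral => //.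
- by move=> w _; rewrite lee_fin normal_pdf_ge0.
- apply/measurable_EFinP; apply: (@measurableT_comp _ _ _ _ _ _ phi).
    exact: measurable_normal_pdf.
  exact: measurable_funB.
- by move=> w _; rewrite lee_fin normal_pdf_ub// gt_eqF.
Qed.

(** Above, [f] is bounded by the peak of the kernel. Below, [1 + ln N - ln f <= N / f] for the
    standard normal density [N]: the ratio has mean 1 along [Y], and [ln N (Y)] is quadratic in [Y],
    so [X^2] and [W^2] control it. *)
Lemma integrable_ln_output : P.-integrable setT (fun w => (ln (f (Y w)))%:E).
Proof.
have := channel_output_density mX mW iX2 sigma0 lawW XW => Yf.
pose N : R -> R := normal_pdf 0%R 1%R.
have iN := integrable_density_ratio mY Yf f0 (@measurable_normal_pdf R 0 1)
  (@normal_pdf_ge0 R 0 1) (@integral_normal_pdf R 0 1).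
have iW2 := integrable_normal_sqr mW lawW sigma0.
pose c : R := (`|ln (normal_peak sigma)| + `|ln (1 ^+ 2 * pi * 2)|)%R.
have ic : P.-integrable setT (EFin \o cst c) by exact: finite_measure_integrable_cst.
have iG := integrableD measurableT (integrableD measurableT ic iN)
  (integrableD measurableT iX2 iW2).
apply: (le_integrable measurableT _ _ iG).
  apply/measurable_EFinP.
  have mlnf : measurable_fun setT (fun y => ln (f y)) by exact: measurableT_comp.
  exact: (measurableT_comp mlnf mY).
move=> w _ /=; rewrite lee_fin (le_trans _ (ler_norm _))//.
set y := (X w + W w)%R.
have NL : (1 + (ln (N y) - ln (f y)) <= N y / f y)%R.
  have N0 : (0 < N y)%R by exact: normal_pdf_gt0.
  by rewrite -{2}(lnK N0) -{2}(lnK (f0 y)) -expRN -expRD expR_ge1Dx.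
have NE : ln (N y) = (- (y ^+ 2) / 2 - ln (1 ^+ 2 * pi * 2) / 2)%R.
  by rewrite /N normal_pdf_expE// expRK subr0 expr1n mul1r.
have N0 : (0 <= N y / f y)%R by rewrite divr_ge0 ?normal_pdf_ge0 ?ltW.
have up : (ln (f y) <= ln (normal_peak sigma))%R.
  by rewrite ler_ln ?posrE ?output_density_le ?normal_peak_gt0 ?gt_eqF.
have y2 : (y ^+ 2 / 2 <= X w ^+ 2 + W w ^+ 2)%R.
  by rewrite /y; have := sqr_ge0 (X w - W w); nra.
have X2 := sqr_ge0 (X w); have W2 := sqr_ge0 (W w).
have l1 := ler_norm (ln (normal_peak sigma)); have l2 := ler_norm (ln (1 ^+ 2 * pi * 2) : R).
have l3 := normr_ge0 (ln (normal_peak sigma)); have l4 := normr_ge0 (ln (1 ^+ 2 * pi * 2) : R).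
rewrite ler_norml /c -/y -/N; apply/andP; split; move: NL; rewrite NE; lra.
Qed.

(* The log-ratio of [f(y) N(x; m(y), V(y))] to the joint density [p(x) phi(y - x)] of (X, Y). *)
Let L (x y : R) : R := (ln (f y) - ln (p x) +
  ((y - x) ^+ 2 / sigma ^+ 2 - (x - m y) ^+ 2 / V y) / 2 - ln (V y / sigma ^+ 2) / 2)%R.

Let mL : measurable_fun setT (fun z : mR * mR => (expR (L z.1 z.2))%R).
Proof.
have c2 (h : R -> R) : measurable_fun setT h -> measurable_fun setT (fun z : mR * mR => h z.2).
  by move=> mh; apply: (@measurableT_comp _ _ _ _ _ _ h).
have c1 (h : R -> R) : measurable_fun setT h -> measurable_fun setT (fun z : mR * mR => h z.1).
  by move=> mh; apply: (@measurableT_comp _ _ _ _ _ _ h).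
apply: measurableT_comp => //; apply: measurable_funB; last first.
  apply: (c2 (fun y => ln (V y / sigma ^+ 2) / 2)%R); apply: measurable_funM => //.
  by apply: measurableT_comp => //; exact: measurable_funM.
apply: measurable_funD.
  apply: measurable_funB; first by apply: (c2 (fun y => ln (f y))); exact: measurableT_comp.
  by apply: (c1 (fun y => ln (p y))); exact: measurableT_comp.
apply: measurable_funM => //; apply: measurable_funB.
  by apply: measurable_funM => //; apply: measurable_funX; exact: measurable_funB.
apply: measurable_funM; last by apply: (c2 (fun y => (V y)^-1)%R); exact: measurable_fun_inv_gt0.
apply: measurable_funX; apply: measurable_funB; first exact: measurable_fst.
exact: c2.
Qed.

(** The form [expR (- ln (p x))], in place of [(p x)^-1], keeps the identity true where [p]
    vanishes. *)
Let L_phi x y : (expR (L x y) * phi (y - x) =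
  f y * normal_pdf (m y) (Num.sqrt (V y)) x * expR (- ln (p x)))%R.
Proof.
have s2 : (0 < sigma ^+ 2)%R by rewrite exprn_gt0.
have V2 : (0 < V y * pi * 2)%R by rewrite !mulr_gt0 ?pi_gt0.
rewrite !normal_pdf_expE// ?sqrtr_gt0// sqr_sqrtr ?ltW//.
rewrite -{1}(lnK (f0 y)) -!expRD; congr expR; rewrite /L.
move: (sigma ^+ 2)%R s2 => s s2.
rewrite !lnM ?posrE ?mulr_gt0 ?invr_gt0 ?pi_gt0// lnV ?posrE//.
by field; rewrite !gt_eqF.
Qed.

Let EL : \int[P]_w (expR (L (X w) (Y w)))%:E <= 1.
Proof.
rewrite (ge0_expectation_sum_indep mX mW lawW XW (h := fun x y => (expR (L x y))%:E)); last 2 first.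
- exact/measurable_EFinP.
- by move=> x y; rewrite lee_fin expR_ge0.
have <- : \int[mu]_y (f y)%:E = 1.
  case: (channel_output_density mX mW iX2 sigma0 lawW XW) => _ [_ <-//].
  by rewrite preimage_setT [LHS]probability_setT.
apply: ge0_le_integral => //.
- move=> y _; apply: integral_ge0 => w _.
  by rewrite -EFinM lee_fin mulr_ge0 ?expR_ge0 ?normal_pdf_ge0.
- pose G (z : T * mR) : \bar R := (expR (L (X z.1) z.2))%:E * (phi (z.2 - X z.1))%:E.
  apply: (measurable_fun_fubini_tonelli_G (m1 := P) G).
    have mX1 : measurable_fun setT (fun z : T * mR => X z.1) by exact: measurableT_comp.
    apply: emeasurable_funM; apply/measurable_EFinP.
      by apply: (@measurableT_comp _ _ _ _ _ _ (fun z : mR * mR => expR (L z.1 z.2)) _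
        (fun z : T * mR => (X z.1 : mR, z.2))) => //; exact: measurable_fun_pair.
    apply: (@measurableT_comp _ _ _ _ _ _ phi); first exact: measurable_normal_pdf.
    exact: measurable_funB.
  by move=> z; rewrite /G -EFinM lee_fin mulr_ge0 ?expR_ge0 ?normal_pdf_ge0.
- exact/measurable_EFinP.
move=> y _; pose N := normal_pdf (m y) (Num.sqrt (V y)).
have N0 x : (0 <= N x)%R by exact: normal_pdf_ge0.
have mN : measurable_fun setT N by exact: measurable_normal_pdf.
rewrite (eq_integral (fun w => (f y * N (X w) * expR (- ln (p (X w))))%:E)); last first.
  by move=> w _; rewrite -EFinM L_phi.
move: (f y) (f0 y) => a a0.
have mK : measurable_fun setT (fun x => (a * N x * expR (- ln (p x)))%R).
  apply: measurable_funM; first exact: measurable_funM.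
  by apply: measurableT_comp => //; apply: measurableT_comp => //; exact: measurableT_comp.
rewrite (ge0_expectation_density mX Xp (h := fun x => (a * N x * expR (- ln (p x)))%:E)); last 2 first.
- exact/measurable_EFinP.
- by move=> x; rewrite lee_fin !mulr_ge0 ?expR_ge0// ltW.
rewrite -[leRHS]mule1 -(@integral_normal_pdf R (m y) (Num.sqrt (V y))) -ge0_integralZl//; last 3 first.
- exact/measurable_EFinP.
- by move=> x _; rewrite lee_fin.
- by rewrite lee_fin ltW.
apply: ge0_le_integral => //.
- by move=> x _; rewrite -EFinM lee_fin !mulr_ge0 ?expR_ge0// ltW.
- by apply: emeasurable_funM; exact/measurable_EFinP.
- by apply: emeasurable_funM; exact/measurable_EFinP.
move=> x _; rewrite -!EFinM lee_fin -(mulrA (a * N x)%R) ler_piMr//.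
  by rewrite mulr_ge0// ltW.
(* Where [p x = 0] the weight from the law of [X] kills the term whatever [ln 0] is, although the
   Gaussian mass there is positive; this is why the mean of [exp L] is only bounded by 1. *)
have [px|px] := eqVneq (p x) 0%R; first by rewrite px mulr0 ltW.
by rewrite expRN lnK ?posrE ?lt0r ?px ?p0// mulVf.
Qed.

Let LV w : R := ln (V (Y w) / sigma ^+ 2)%R.
Let A w : R := ln (f (Y w)).
Let B w : R := ln (p (X w)).
Let C w : R := ((X w - m (Y w)) ^+ 2 / V (Y w))%R.
Let D w : R := (W w ^+ 2 / sigma ^+ 2)%R.
Let t w : R := expR (L (X w) (Y w)).

Let mLV : measurable_fun setT LV.
Proof.
have mlnV : measurable_fun setT (fun y => ln (V y / sigma ^+ 2))%R.
  by apply: measurableT_comp => //; exact: measurable_funM.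
exact: (measurableT_comp mlnV mY).
Qed.

(** Twice [1 + L <= exp L], rearranged so that it can be read as a lower bound on [LV] before [LV]
    is known to be integrable. *)
Let gibbs w : (2 * A w + D w + 2 <= LV w + C w + 2 * t w + 2 * B w)%R.
Proof.
have := expR_ge1Dx (L (X w) (Y w)); rewrite -/(t w) /L (addrC (X w)) addrK.
rewrite -/(D w) (addrC (W w)) -/(A w) -/(B w) -/(C w) -/(LV w); lra.
Qed.

Let it : P.-integrable setT (fun w => (t w)%:E).
Proof.
apply/integrableP; split.
  apply/measurable_EFinP.
  apply: (@measurableT_comp _ _ _ _ _ _ (fun z : mR * mR => expR (L z.1 z.2)) _
    (fun w => (X w : mR, Y w : mR))) => //.
  exact: measurable_fun_pair.
rewrite (eq_integral (fun w => (t w)%:E)); first by rewrite (le_lt_trans EL) ?ltry.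
by move=> w _ /=; rewrite ger0_norm// expR_ge0.
Qed.

Let uC (x y : R) : R := ((x - m y) ^+ 2 / V y)%R.

Let uC0 x y : (0 <= uC x y)%R. Proof. by rewrite divr_ge0 ?sqr_ge0 ?ltW. Qed.

Let muC : measurable_fun setT (fun z : mR * mR => uC z.1 z.2).
Proof.
apply: measurable_funM.
  apply: measurable_funX; apply: measurable_funB; first exact: measurable_fst.
  by apply: (@measurableT_comp _ _ _ _ _ _ m).
by apply: (@measurableT_comp _ _ _ _ _ _ (fun y => (V y)^-1)%R) => //; exact: measurable_fun_inv_gt0.
Qed.

(** At each fixed output the square of [X - m y] has conditional mean [V y], so the normalized
    square has conditional mean 1. *)
Let EC : \int[P]_w (C w)%:E = 1.
Proof.
have uC1 y : \int[P]_w (uC (X w) y * phi (y - X w))%:E = ((cst 1 y) * f y)%:E.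
  rewrite (eq_integral (fun w => (V y)^-1%:E * ((X w - m y) ^+ 2 * phi (y - X w))%:E)); last first.
    by move=> w _; rewrite -EFinM /uC; congr (_%:E); ring.
  rewrite ge0_integralZl//.
  - by rewrite -post_varE// -EFinM mulrA mulVf ?gt_eqF.
  - apply/measurable_EFinP; apply: measurable_funM.
      apply: measurable_funX; apply: measurable_funB; first exact: mX.
      exact: measurable_cst.
    apply: (@measurableT_comp _ _ _ _ _ _ phi); first exact: measurable_normal_pdf.
    exact: measurable_funB.
  - by move=> w _; rewrite lee_fin mulr_ge0 ?sqr_ge0 ?normal_pdf_ge0.
  - by rewrite lee_fin invr_ge0 ltW.
have := conditional_integral mX mW iX2 sigma0 lawW XW muC uC0
  (measurable_cst (1%R : R)) uC1 (@measurableT _ R).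
rewrite preimage_setT => ->.
by rewrite (eq_integral (cst 1))// integral_cst// [X in _ * X]probability_setT mule1.
Qed.

Let C0 w : (0 <= C w)%R. Proof. exact: uC0. Qed.

Let iC : P.-integrable setT (fun w => (C w)%:E).
Proof.
apply/integrableP; split.
  apply/measurable_EFinP.
  apply: (@measurableT_comp _ _ _ _ _ _ (fun z : mR * mR => uC z.1 z.2) _
    (fun w => (X w : mR, Y w : mR))) => //.
  exact: measurable_fun_pair.
rewrite (eq_integral (fun w => (C w)%:E)); first by rewrite EC ltry.
by move=> w _ /=; rewrite ger0_norm.
Qed.

Let iD : P.-integrable setT (fun w => (D w)%:E).
Proof.
have := integrableZl measurableT ((sigma ^+ 2)^-1)%R (integrable_normal_sqr mW lawW sigma0).
by apply: eq_integrable => // w _; rewrite -EFinM mulrC.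
Qed.

Hypothesis ip : mu.-integrable setT (fun x => (p x * ln (p x))%:E).

Lemma integrable_ln_input : P.-integrable setT (fun w => (ln (p (X w)))%:E).
Proof.
apply: (integrable_expectation_density mX Xp (h := fun x => ln (p x))) => //.
exact: measurableT_comp.
Qed.

(** Above, [ln x <= x] reduces to the integrability of [V (Y)]; below, [gibbs] bounds [LV] by
    integrable terms once [D >= 0] is dropped. *)
Lemma integrable_ln_post_var :
  P.-integrable setT (fun w => (ln (V (Y w) / sigma ^+ 2))%:E).
Proof.
have iA := integrable_norm integrable_ln_output.
have iB := integrable_norm integrable_ln_input.
have iV := integrableZl measurableT ((sigma ^+ 2)^-1)%R
  (integrable_post_var mX mW iX2 sigma0 lawW XW).
have iG := integrableD measurableT
  (integrableD measurableT iC (integrableZl measurableT 2%R it))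
  (integrableD measurableT (integrableZl measurableT 2%R iA) (integrableZl measurableT 2%R iB)).
apply: (le_integrable measurableT _ _ (integrableD measurableT iV iG)).
  exact/measurable_EFinP.
move=> w _ /=; rewrite lee_fin (le_trans _ (ler_norm _))//.
have g := gibbs w; have c0 := C0 w.
have t0 : (0 <= t w)%R by exact: expR_ge0.
have d0 : (0 <= D w)%R by rewrite divr_ge0 ?sqr_ge0.
have Vs : (0 < V (Y w) / sigma ^+ 2)%R by rewrite divr_gt0 ?exprn_gt0.
have up : (LV w <= (sigma ^+ 2)^-1 * V (Y w))%R.
  rewrite [leRHS]mulrC -[leRHS](lnK Vs).
  by rewrite (le_trans _ (expR_ge1Dx _))// lerDr.
have v0 : (0 <= (sigma ^+ 2)^-1 * V (Y w))%R by rewrite mulrC ltW.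
have a1 := ler_norm (- A w); have b1 := ler_norm (B w); rewrite normrN in a1.
have a2 := normr_ge0 (A w); have b2 := normr_ge0 (B w).
rewrite -/(LV w) -/(A w) -/(B w) ler_norml; apply/andP; split; lra.
Qed.

Lemma expectation_ln_post_var_ge :
  2%:E * \int[P]_w (ln (f (Y w)))%:E <=
  \int[P]_w (ln (V (Y w) / sigma ^+ 2))%:E + 2%:E * \int[P]_w (ln (p (X w)))%:E.
Proof.
have iA : P.-integrable setT (fun w => (A w)%:E) by exact: integrable_ln_output.
have iB : P.-integrable setT (fun w => (B w)%:E) by exact: integrable_ln_input.
have iLV : P.-integrable setT (fun w => (LV w)%:E) by exact: integrable_ln_post_var.
have i2 : P.-integrable setT (EFin \o cst 2%R) by exact: finite_measure_integrable_cst.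
have i2A := integrableZl measurableT 2%R iA.
have i2B := integrableZl measurableT 2%R iB.
have i2t := integrableZl measurableT 2%R it.
have iAD := integrableD measurableT i2A iD.
have iLC := integrableD measurableT iLV iC.
have iLCt := integrableD measurableT iLC i2t.
(* After integration the constant 2 absorbs [2 E t <= 2], and [E D >= 1] absorbs [E C = 1]. *)
have : \int[P]_w (2%:E * (A w)%:E + (D w)%:E + 2%:E) <=
    \int[P]_w ((LV w)%:E + (C w)%:E + 2%:E * (t w)%:E + 2%:E * (B w)%:E).
  apply: le_integral => //.
  - exact: integrableD.
  - exact: integrableD.
  - by move=> w _; rewrite -!EFinM -!EFinD lee_fin; exact: gibbs.
rewrite integralD// integralD// integralZl// integral_cst// [X in _ + _ * X <= _]probability_setT mule1.
rewrite integralD// integralD// integralD// integralZl// integralZl// EC.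
have := EL; have := normal_second_moment_ge mW lawW sigma0.
rewrite -/(\int[P]_w (t w)%:E).
have /fineK <- := integrable_fin_num measurableT iA.
have /fineK <- := integrable_fin_num measurableT iB.
have /fineK <- := integrable_fin_num measurableT iLV.
have /fineK <- := integrable_fin_num measurableT iD.
have /fineK <- := integrable_fin_num measurableT it.
rewrite -!EFinM -!EFinD !lee_fin; lra.
Qed.

End entropy_bound.

(** * The entropy identity and inequality for arbitrary versions of the conditional mean and
    variance *)

Theorem theorem1 (d : measure_display) (T : measurableType d) (R : realType)
  (P : probability T R) (X W : T -> R) (pX : R -> R) (sigma : R) :
  measurable_fun setT X -> measurable_fun setT W ->
  P.-integrable setT (fun w => (X w ^+ 2)%:E) ->
  is_density P X pX ->
  lebesgue_measure.-integrable setT (fun x => (pX x * ln (pX x))%:E) ->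
  (0 < sigma)%R ->
  (forall A : set R, measurable A -> P (W @^-1` A) = normal_prob 0 sigma A) ->
  indep2 P X W ->
  forall g v : R -> R,
  cond_exp_fun P (fun w => X w + W w)%R X g ->
  cond_var_fun P (fun w => X w + W w)%R X g v ->
  exists pY q : R -> R,
    is_density P (fun w => X w + W w)%R pY /\
    is_density P (fun w => g (X w + W w))%R q /\
    entropy q = entropy pY +
      \int[P]_w (ln (v (X w + W w) / sigma ^+ 2))%:E /\
    entropy q + entropy pY >= 2%:E * entropy pX.
Proof.
move=> mX mW iX2 Xp ip s0 lawW XW g v gP vP.
set Y := fun w => (X w + W w)%R.
have mY : measurable_fun setT Y by exact: measurable_funD.
pose f := weighted_moment P X sigma 0.
pose m := post_mean P X sigma.
pose V := post_var P X sigma.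
pose m' y := (V y / sigma ^+ 2)%R.
have Yf : is_density P Y f := channel_output_density mX mW iX2 s0 lawW XW.
have [mf [f0 Pf]] := Yf.
have f_gt0 y : (0 < f y)%R by exact: weighted_moment0_gt0.
have X0 := density_atomless Xp.
have m'_gt0 y : (0 < m' y)%R by rewrite divr_gt0 ?exprn_gt0// post_var_gt0.
have cm' : continuous m'.
  by move=> y; apply: cvgM; [exact: continuous_post_var|exact: cvg_cst].
have dm (y : R) : is_derive y 1%R m (m' y) by exact: is_derive_post_mean.
have mm : measurable_fun setT m by exact: measurable_post_mean.
have mg : measurable_fun setT g by case: gP.
have mv : measurable_fun setT v by case: vP.
have gm : {ae P, forall w, g (Y w) = m (Y w)} by exact: cond_exp_ae_post_mean gP.
have vV : {ae P, forall w, v (Y w) = V (Y w)} by exact: cond_var_ae_post_var gP vP.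
have iA := integrable_ln_output mX mW iX2 s0 lawW XW.
have iLV := integrable_ln_post_var mX mW iX2 Xp s0 lawW XW ip.
pose q := increasing_image_density m m' f.
have mq : measurable_fun setT q by exact: measurable_increasing_image_density.
have mgY : measurable_fun setT (fun w => g (Y w)) by exact: measurableT_comp.
have mmY : measurable_fun setT (fun w => m (Y w)) by exact: measurableT_comp.
have gq : is_density P (fun w => g (Y w)) q.
  split; first exact: mq.
  split; first exact: increasing_image_density_ge0.
  move=> A mA; rewrite -integral_increasing_image_density// -Pf; last first.
    by rewrite -[X in measurable X]setTI; exact: mm.
  (* Written as integrals of indicators, the probabilities for [g (Y)] and [m (Y)] can be compared
     through the almost sure equality [gm]. *)
  have PE (Z : T -> R) : measurable_fun setT Z -> P (Z @^-1` A) = \int[P]_w (\1_A (Z w))%:E.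
    move=> mZ; rewrite -[RHS]/(\int[P]_w (\1_(Z @^-1` A) w)%:E) integral_indic ?setIT//.
    by rewrite -[X in measurable X]setTI; exact: mZ.
  rewrite PE// -[X in _ = P X]/((fun w => m (Y w)) @^-1` A) PE//.
  apply: ae_eq_integral => //.
  - by apply/measurable_EFinP; apply: (@measurableT_comp _ _ _ _ _ _ (\1_A : R -> R)).
  - by apply/measurable_EFinP; apply: (@measurableT_comp _ _ _ _ _ _ (\1_A : R -> R)).
  - by apply: filterS gm => w -> .
have hX := entropyE mX Xp.
have hY := entropyE mY Yf.
have hq : entropy q = - (\int[P]_w (ln (f (Y w)))%:E) + \int[P]_w (ln (V (Y w) / sigma ^+ 2))%:E.
  rewrite (entropyE mgY gq) -oppeB ?fin_num_adde_defl ?fin_numN ?integrable_fin_num//.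
  rewrite -integralB//; congr (- _); apply: ae_eq_integral => //.
  - have mlnq : measurable_fun setT (fun u => ln (q u)) by exact: measurableT_comp.
    exact/measurable_EFinP/(measurableT_comp mlnq mgY).
  - by apply: emeasurable_funB; [case/integrableP: iA|case/integrableP: iLV].
  - apply: filterS gm => w -> _; rewrite /q increasing_image_densityE//.
    by rewrite -EFinB ln_div ?posrE.
have vE : \int[P]_w (ln (v (Y w) / sigma ^+ 2))%:E = \int[P]_w (ln (V (Y w) / sigma ^+ 2))%:E.
  apply: ae_eq_integral => //.
  - apply/measurable_EFinP; apply: measurableT_comp => //; apply: measurable_funM => //.
    exact: measurableT_comp.
  - by case/integrableP: iLV.
  - by apply: filterS vV => w -> .
exists f, q; split => //; split => //; split.
  by rewrite hq hY vE.
have := expectation_ln_post_var_ge mX mW iX2 Xp s0 lawW XW ip.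
have iB := integrable_ln_input mX Xp ip.
rewrite hq hY hX -/f -/V -/Y.
have /fineK <- := integrable_fin_num measurableT iA.
have /fineK <- := integrable_fin_num measurableT iB.
have /fineK <- := integrable_fin_num measurableT iLV.
rewrite -!EFinN -!EFinM -!EFinD !lee_fin; lra.
Qed.
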